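(* Let $\gamma>1$ and $T\in\mathbb{N}$ be arbitrary. For each $L\in\mathbb{N}$, define the sequence $\mathbf{d}^{(L)}:=\{(n+L)^\gamma\}_{n=1}^\infty$. Then for all sufficiently large $L$ (so that in particular $\mathbf{d}^{(L)}\in\mathcal{D}$), both $\mathcal{F}=\mathcal{F}(\mathbf{d}^{(L)},T)$ and $\mathcal{G}=\mathcal{G}(\mathbf{d}^{(L)},T)$ are CIFSs and, with $h_{\mathcal{F}}=\dim_H(J_{\mathcal{F}})$ and $h_{\mathcal{G}}=\dim_H(J_{\mathcal{G}})$, $$H_{h_{\mathcal{F}}}(J_{\mathcal{F}})=H_{h_{\mathcal{G}}}(J_{\mathcal{G}})=0.$$
   Context: Notation. $\mathbb{N}$ is the set of positive integers, $\mathbb{D}=\{z\in\mathbb{C}:|z|<1\}$, $\mathbb{C}$ is identified with $\mathbb{R}^2$, $e(\theta)=e^{2\pi\sqrt{-1}\,\theta}$. $\dim_H$ is Hausdorff dimension and $H_t$ is the $t$-dimensional Hausdorff measure. CIFS. Let $X\subset\mathbb{R}^d$ be compact and connected and $I$ a countable (possibly finite) set with at least two elements. A family $\mathcal{S}=\{s_i:X\to X\}_{i\in I}$ of injective contractions is an IFS if $\sup_{i}\mathrm{Lip}(s_i)<1$. For $\omega=(\omega_1,\dots,\omega_N)\in I^N$ put $s_\omega=s_{\omega_1}\circ\dots\circ s_{\omega_N}$. The limit set is $J_{\mathcal{S}}=\bigcup_{\omega\in I^{\mathbb{N}}}\bigcap_{N\ge1}s_{\omega|_N}(X)$, where $\omega|_N=(\omega_1,\dots,\omega_N)$.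 An IFS $\mathcal{S}$ is a conformal IFS (CIFS) if: (Open Set Condition) $s_i(\mathrm{Int}\,X)\cap s_j(\mathrm{Int}\,X)=\emptyset$ for $i\ne j$; (Cone Condition) there are $0<\alpha<\pi/2$, $l>0$ such that for every $x\in\partial X$ there is $u_x\neq0$ with $\{y:0<|y-x|<l,\ \langle y-x,u_x\rangle>|y-x||u_x|\cos\alpha\}\subset\mathrm{Int}(X)$; (Conformality) there is an open connected $V\supset X$ such that all $s_i$ extend to $C^{1+\varepsilon}$ diffeomorphisms on $V$ that are conformal on $V$; (Bounded Distortion) there is $K\ge1$ with $|s_\omega'(y)|\le K|s_\omega'(x)|$ for all $\omega\in\bigcup_N I^N$, $x,y\in V$, where $|s'_\omega(x)|$ is the operator norm of the derivative. The systems. $\mathcal{D}$ is the set of real sequences $\{d_n\}_{n\ge1}$ with $d_1\ge2$ and $d_{n+1}-d_n\ge2$ for all $n$. For $\alpha\in\mathbb{C}$, $|\alpha|\ge2$, define $f_\alpha,g_\alpha:\overline{\mathbb{D}}\to\overline{\mathbb{D}}$ by $f_\alpha(z)=\frac{z+\overline{\alpha}}{|\alpha|^2-1}$, $g_\alpha(z)=\frac1{z+\alpha}$. For $\mathbf{d}=\{d_n\}\in\mathcal{D}$, $T\in\mathbb{N}$: $\mathcal{F}(\mathbf{d},T)=\{f_{e(j/T)d_n}:n\in\mathbb{N},\,j=0,\dots,T-1\}$ and $\mathcal{G}(\mathbf{d},T)=\{g_{e(j/T)d_n}:n\in\mathbb{N},\,j=0,\dots,T-1\}$, families of maps on $X=\overline{\mathbb{D}}$.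 *)

(* Defs.v *)
(* MathComp / MathComp-Analysis, over an arbitrary [R : realType]. *)
From HB Require Import structures.
From mathcomp Require Import all_boot all_order all_algebra.
From mathcomp Require Import all_classical all_reals all_analysis.
From mathcomp Require Import complex.

Set Implicit Arguments.
Unset Strict Implicit.
Unset Printing Implicit Defensive.

Import Order.TTheory GRing.Theory Num.Theory.
Import numFieldNormedType.Exports.

Local Open Scope classical_set_scope.
Local Open Scope ring_scope.
Local Open Scope complex_scope.

(* The library norm on ['rV[R]_m] is the sup norm.  It induces the Euclidean
   topology and the usual derivative, so [open], [compact], ['d f x], etc. are
   the library's; every metric quantity below uses the Euclidean [enorm]. *)
Section Euclidean.
Variables (R : realType) (m : nat).
Local Notation E := 'rV[R]_m.

Definition edot (x y : E) : R := \sum_(i < m) x 0 i * y 0 i.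
Definition enorm (x : E) : R := Num.sqrt (edot x x).

(* For linear [A] the set is nonempty and bounded, so [sup] is the true one. *)
Definition opnorm (A : E -> E) : R :=
  sup [set enorm (A v) | v in [set v | enorm v <= 1]].

Definition Lip (X : set E) (f : E -> E) : \bar R :=
  ereal_sup [set r | exists x y, [/\ X x, X y, x != y &
    r = (enorm (f x - f y) / enorm (x - y))%:E]].

Definition boundary (X : set E) : set E := closure X `\` X°.

Definition diam (U : set E) : \bar R :=
  ereal_sup [set r | exists x y, [/\ U x, U y & r = (enorm (x - y))%:E]].

(* The empty set has weight 0 and every other set weight [diam U ^ t], with
   the convention 0 ^ 0 = 1 ([poweR]), so that [hausdorff_measure 0] is the
   counting measure. *)
Definition hweight (t : R) (U : set E) : \bar R :=
  if U == set0 then 0%E else (diam U `^ t)%E.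

Definition hausdorff_premeasure (t delta : R) (A : set E) : \bar R :=
  ereal_inf [set (\sum_(0 <= k <oo) hweight t (U k))%E | U in
    [set U : nat -> set E |
      A `<=` \bigcup_k U k /\ forall k, (diam (U k) <= delta%:E)%E]].

(* The premeasure is nonincreasing in [delta], so the limit as delta -> 0+ is
   the supremum. *)
Definition hausdorff_measure (t : R) (A : set E) : \bar R :=
  ereal_sup [set hausdorff_premeasure t delta A | delta in
    [set delta : R | 0 < delta]].

(* The set is bounded below by 0 and contains every t > m, so the real [inf]
   is the true infimum. *)
Definition hausdorff_dim (A : set E) : R :=
  inf [set t : R | 0 <= t /\ hausdorff_measure t A = 0%E].

(* Derivative eps-Hoelder on all of [V]; for eps > 0 this entails that it is
   continuous. *)
Definition C1_hoelder (eps : R) (V : set E) (f : E -> E) : Prop :=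
  (forall x, V x -> differentiable f x) /\
  exists C : R, forall x y, V x -> V y ->
    opnorm (fun v => 'd f x v - 'd f y v) <= C * enorm (x - y) `^ eps.

Definition C1_hoelder_diffeo (eps : R) (V : set E) (f : E -> E) : Prop :=
  [/\ C1_hoelder eps V f, open (f @` V) &
      exists g : E -> E,
        C1_hoelder eps (f @` V) g /\ forall x, V x -> g (f x) = x].

Definition conformal_on (V : set E) (f : E -> E) : Prop :=
  forall x, V x -> differentiable f x /\
    exists2 r : R, 0 < r & forall v, enorm ('d f x v) = r * enorm v.

End Euclidean.

(* A system on [X] is a family of total functions, of which only the
   restrictions to [X] matter. *)
Section IteratedFunctionSystems.
Variables (R : realType) (m : nat) (I : Type).
Local Notation E := 'rV[R]_m.
Implicit Types (X V : set E) (s t : I -> E -> E).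

Definition word_map s (w : seq I) : E -> E :=
  foldr (fun i f => s i \o f) id w.

Definition limit_set X s : set E :=
  \bigcup_(w in [set: nat -> I])
    \bigcap_(N in [set N | (1 <= N)%N]) (word_map s (mkseq w N) @` X).

Definition is_IFS X s : Prop :=
  [/\ compact X, connected X,
      countable [set: I] /\ (exists i j : I, i <> j),
      forall i, s i @` X `<=` X /\ {in X &, injective (s i)} &
      (ereal_sup (range (fun i => Lip X (s i))) < 1%E)%E].

Definition open_set_condition X s : Prop :=
  forall i j, i <> j -> (s i @` X°) `&` (s j @` X°) = set0.

Definition cone_condition X : Prop :=
  exists alpha l : R, [/\ 0 < alpha, alpha < pi / 2, 0 < l &
    forall x, boundary X x -> exists2 u : E, u != 0 &
      [set y | 0 < enorm (y - x) < l /\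
         edot (y - x) u > enorm (y - x) * enorm u * cos alpha] `<=` X°].

(* [t i] is the extension of [s i].  It must map [V] into itself for the
   compositions [word_map t w] to be extensions of the [word_map s w] to [V]. *)
Definition conformal_extension X V s t : Prop :=
  [/\ open V, connected V, X `<=` V &
      exists2 eps : R, 0 < eps & forall i,
        [/\ {in X, t i =1 s i}, t i @` V `<=` V,
            C1_hoelder_diffeo eps V (t i) & conformal_on V (t i)]].

Definition bounded_distortion V t : Prop :=
  exists2 K : R, 1 <= K & forall (w : seq I) x y, (0 < size w)%N ->
    V x -> V y ->
    opnorm ('d (word_map t w) y) <= K * opnorm ('d (word_map t w) x).

Definition is_CIFS X s : Prop :=
  [/\ is_IFS X s, open_set_condition X s, cone_condition X &
      exists V t, conformal_extension X V s t /\ bounded_distortion V t].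

End IteratedFunctionSystems.

Section Systems.
Variable R : realType.

Definition to_plane (z : R[i]) : 'rV[R]_2 :=
  \row_(k < 2) (if k == 0 then complex.Re z else complex.Im z).
Definition of_plane (v : 'rV[R]_2) : R[i] := v 0 0 +i* v 0 1.

Definition plane_map (phi : R[i] -> R[i]) : 'rV[R]_2 -> 'rV[R]_2 :=
  to_plane \o phi \o of_plane.

Definition unit_disc : set 'rV[R]_2 := [set v | `|of_plane v| < 1].
Definition closed_disc : set 'rV[R]_2 := closure unit_disc.

Definition cis (theta : R) : R[i] :=
  cos (2 * pi * theta) +i* sin (2 * pi * theta).

(* A sequence (d_n)_{n >= 1} is a function on [nat] whose value at 0 is
   ignored. *)
Definition admissible (d : nat -> R) : Prop :=
  2 <= d 1%N /\ forall n, (1 <= n)%N -> 2 <= d n.+1 - d n.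

Definition f_map (alpha z : R[i]) : R[i] :=
  (z + alpha^*) / (`|alpha| ^+ 2 - 1).
Definition g_map (alpha z : R[i]) : R[i] := 1 / (z + alpha).

(* The index (n, j) stands for the pair (n + 1, j): positive integers are
   enumerated from 0. *)
Definition param (d : nat -> R) (T : nat) (p : nat * 'I_T) : R[i] :=
  cis (p.2%:R / T%:R) * (d p.1.+1)%:C.

Definition F_system (d : nat -> R) (T : nat) (p : nat * 'I_T) :=
  plane_map (f_map (param d p)).
Definition G_system (d : nat -> R) (T : nat) (p : nat * 'I_T) :=
  plane_map (g_map (param d p)).

Definition power_seq (gamma : R) (L : nat) (n : nat) : R :=
  (n + L)%:R `^ gamma.

End Systems.

Arguments closed_disc {R}.

(* Main.v *)
(* For a word w let rho_w be the ratio by which s_w scales a fixed segment.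
   Every word map has the two-point form
   s_w x - s_w y = e (x - y) / ((c x + d) (c y + d)) with pole far from the disc,
   so s_w distorts distances by rho_w up to a constant K and rho is
   multiplicative up to K.  Let h be the dimension and
   Z_n = sum of rho_w ^ h over the words of length n.

   If some Z_n, restricted to a finite alphabet, exceeded K ^ h, then so would
   the sum with some exponent t > h, and the finite separated subsystem would
   satisfy H_t > 0, contradicting t > h.  Hence Z_n <= K ^ h for all n.  If
   inf Z_n = 0, the covers by cylinders give H_h = 0.  Otherwise Z_n >= c > 0,
   and splitting words at their first letter of index >= N bounds the sum over
   all words in the first N letters by a constant over S_N, the sum of
   rho_i ^ h over the letters of index between N and 2 N.  Covering the images
   of all letters of index >= N, which cluster at 0, by one set of diameter
   about N ^ (- gamma) costs in total about
   N ^ (- gamma h) / S_N <= N ^ (gamma h - 1), up to a constant.  For large L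
   one has h <= 3 / (4 gamma), so this tends to 0. *)
Require Import Defs.
From HB Require Import structures.
From mathcomp Require Import all_boot all_order all_algebra.
From mathcomp Require Import all_classical all_reals all_analysis.
From mathcomp Require Import complex ring lra.

Set Implicit Arguments.
Unset Strict Implicit.
Unset Printing Implicit Defensive.

Import Order.TTheory GRing.Theory Num.Theory.
Import numFieldNormedType.Exports.

Local Open Scope classical_set_scope.
Local Open Scope ring_scope.

(** * Covers and Hausdorff measure *)

(** One argument serves both systems because f_alpha and g_alpha map the closed disc onto the same
    disc: inverted, it is the disc of radius 1 about alpha. Separation and clustering at 0 are thus
    read off from the parameters alone. The measure vanishes because ratios and positions scale
    differently. A letter of index about N has an image of size N ^ (- 2 gamma), but all these
    images lie within N ^ (- gamma) of 0. At exponent h, with gamma h < 1, one set around the N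
    images is cheaper than the N images taken separately. No conformal measure is constructed: its
    role is played by sums over words in finite alphabets, which are continuous in the exponent and
    bounded uniformly in the alphabet. The tail cover leaves over the codings that stay among the
    first N letters for k steps. The sums Z_j over these letters have a bounded total, so some level
    k makes the leftover cheap. The distortion constant is K = 25 = 5 ^ 2: on the disc of radius 2
    each denominator c x + d of a word map varies by a factor of at most 5. *)

Section HausdorffCovers.
Variables (R : realType) (m : nat).
Local Notation E := 'rV[R]_m.
Implicit Types (A U : set E) (s t : R).

Lemma enorm_ge0 (x : E) : 0 <= enorm x.
Proof. exact: sqrtr_ge0. Qed.

Lemma diam_ge0 U : U !=set0 -> (0 <= diam U)%E.
Proof.
move=> [x Ux]; apply: (@le_trans _ _ (enorm (x - x))%:E).
  by rewrite lee_fin enorm_ge0.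
by apply: ereal_sup_ubound; exists x, x.
Qed.

Lemma diam_ge U x y : U x -> U y -> ((enorm (x - y))%:E <= diam U)%E.
Proof. by move=> Ux Uy; apply: ereal_sup_ubound; exists x, y. Qed.

Lemma diam_le U (c : \bar R) :
  (forall x y, U x -> U y -> ((enorm (x - y))%:E <= c)%E) -> (diam U <= c)%E.
Proof. by move=> H; apply: ge_ereal_sup => _ [x [y [Ux Uy ->]]]; apply: H. Qed.

Lemma hweight_ge0 t U : (0 <= hweight t U)%E.
Proof. by rewrite /hweight; case: ifP => // _; exact: poweR_ge0. Qed.

Lemma hweight_set0 t : hweight t (@set0 E) = 0%E.
Proof. by rewrite /hweight eqxx. Qed.

Lemma hweight_le t U (c : R) : 0 <= t -> 0 <= c ->
  (forall x y, U x -> U y -> enorm (x - y) <= c) ->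
  (hweight t U <= (c `^ t)%:E)%E.
Proof.
move=> t0 c0 H; rewrite /hweight; case: ifPn => [_|/set0P U0].
  by rewrite lee_fin powR_ge0.
rewrite -poweR_EFin.
move: t0; rewrite le_eqVlt => /predU1P[<-|t0].
  by rewrite !poweRe0.
apply: gt0_ler_poweR.
- exact: ltW.
- by rewrite in_itv/= diam_ge0//= leey.
- by rewrite in_itv/= lee_fin c0/= leey.
- by apply: diam_le => x y Ux Uy; rewrite lee_fin H.
Qed.

Lemma hweight_antitone s t U : 0 <= s -> s < t -> (diam U <= 1%:E)%E ->
  (hweight t U <= hweight s U)%E.
Proof.
move=> s0 st U1; rewrite /hweight; case: ifPn => // /set0P U0.
move: (diam_ge0 U0) U1; case: (diam U) => [r||] //.
rewrite !lee_fin => r0 r1.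
have [->|rn0] := eqVneq r 0.
  by rewrite (powR0 (x := t)) ?powR_ge0// gt_eqF// (le_lt_trans s0).
by apply: ger_powR (ltW st); rewrite r1 lt_def rn0 r0.
Qed.

(** For positive [t], a total weight of at most [delta] to the power [t] already forces every set of
    the cover to have diameter at most [delta]. Hence the covers need no bound on their
    diameters. *)
Lemma hausdorff_measure_eq0 t A : 0 < t ->
  (forall e : R, 0 < e -> exists V : nat -> set E, A `<=` \bigcup_k V k /\
     (\sum_(0 <= k <oo) hweight t (V k) <= e%:E)%E) ->
  hausdorff_measure t A = 0%E.
Proof.
move=> t0 H.
have pre_ge0 delta : (0 <= hausdorff_premeasure t delta A)%E.
  apply: le_ereal_inf_tmp => _ [U _ <-].
  by apply: nneseries_ge0 => k _ _; exact: hweight_ge0.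
apply/eqP; rewrite eq_le; apply/andP; split; last first.
  apply: (le_trans (pre_ge0 1)); apply: ereal_sup_ubound.
  by exists 1 => //=; exact: ltr01.
apply: ge_ereal_sup => _ [delta /= delta0 <-].
apply/lee_addgt0Pr => e e0; rewrite add0e.
have dt0 : 0 < delta `^ t by exact: powR_gt0.
have [V [AV Vs]] := H (Num.min e (delta `^ t)) (ltac:(by rewrite lt_min e0)).
apply: (@le_trans _ _ (\sum_(0 <= k <oo) hweight t (V k))%E); last first.
  by apply: (le_trans Vs); rewrite lee_fin ge_min lexx.
apply: ereal_inf_lbound; exists V => //; split=> // k.
have [->|/eqP/set0P V0] := pselect (V k = set0).
  by apply: ge_ereal_sup => _ [x [y [[]]]].
have : (hweight t (V k) <= (delta `^ t)%:E)%E.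
  apply: (@le_trans _ _ (\sum_(0 <= k <oo) hweight t (V k))%E); last first.
    by apply: (le_trans Vs); rewrite lee_fin ge_min lexx orbT.
  rewrite (nneseriesD1 (n := k)) //; last by move=> *; exact: hweight_ge0.
  by apply: leeDl; apply: nneseries_ge0 => *; exact: hweight_ge0.
rewrite /hweight; case: ifPn => [/eqP Vk0|_].
  by move/set0P/eqP: V0.
apply: contraTT; rewrite -!ltNge => dV.
case E : (diam (V k)) dV => [r||] //; last first.
  by rewrite poweRyr ?gt_eqF// => _; rewrite ltry.
rewrite lte_fin => dr; rewrite poweR_EFin lte_fin.
by apply: gt0_ltr_powR => //; rewrite nnegrE ltW// (lt_trans delta0).
Qed.

(** Numbers that code no element of [T] get the empty set, whose weight is 0 at every exponent. Only
    finite subfamilies have to be estimated. *)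
Lemma countable_cover (T : countType) (U : T -> set E) A t (c : \bar R) :
  A `<=` \bigcup_x U x ->
  (forall s : seq T, uniq s -> (\sum_(x <- s) hweight t (U x) <= c)%E) ->
  exists V : nat -> set E, A `<=` \bigcup_k V k /\
     (\sum_(0 <= k <oo) hweight t (V k) <= c)%E.
Proof.
move=> AU sumU; pose V k := if pickle_inv k is Some x then U x else set0.
exists V; split.
  move=> a /AU [x _ Uxa]; exists (pickle x) => //.
  by rewrite /V pickleK_inv.
apply: lime_le.
  by apply: is_cvg_nneseries => *; exact: hweight_ge0.
apply: nearW => n.
pose s := pmap (@pickle_inv T) (iota 0 n).
have -> : (\sum_(0 <= k < n) hweight t (V k) =
    \sum_(x <- s) hweight t (U x))%E.
  rewrite /s /index_iota subn0; elim: (iota 0 n) => [|k l IH] /=.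
    by rewrite !big_nil.
  rewrite big_cons IH /V; case: (pickle_inv k) => [x|] /=.
    by rewrite big_cons.
  by rewrite hweight_set0 add0e.
apply: sumU; apply: (@pmap_uniq _ _ _ (@pickle T)) (iota_uniq _ _).
exact: pickle_invK.
Qed.

Lemma cover_lt_of_measure0 t A (delta e : R) : hausdorff_measure t A = 0%E ->
  0 < delta -> 0 < e -> exists V : nat -> set E, [/\ A `<=` \bigcup_k V k,
    forall k, (diam (V k) <= delta%:E)%E &
    (\sum_(0 <= k <oo) hweight t (V k) < e%:E)%E].
Proof.
move=> mA0 delta0 e0.
have : (hausdorff_premeasure t delta A < e%:E)%E.
  apply: (@le_lt_trans _ _ (hausdorff_measure t A)); last by rewrite mA0 lte_fin.
  by apply: ereal_sup_ubound; exists delta.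
by move=> /ereal_inf_lt[_ [V [AV Vd] <-] Ve]; exists V.
Qed.

End HausdorffCovers.

(** * A lower bound for separated iterated function systems *)

Section PrefixAvoidance.
Variables (R : realType) (W : eqType).
Implicit Types (A u : seq W) (a l : W -> R).

(** At most one one-letter extension of [u] is a prefix of [v]. *)
Lemma sum_prefix_rcons_le A u v (c : R) : uniq A -> 0 <= c ->
  \sum_(i <- A) (if prefix (rcons u i) v then c else 0) <=
    if prefix u v then c else 0.
Proof.
move=> uA c0; have [/prefixP[v' ->]|puv] := boolP (prefix u v); last first.
  rewrite big1// => i _; case: ifP => // /(prefix_trans (prefix_rcons _ _)).
  by rewrite (negbTE puv).
case: v' => [|j v'].
  rewrite cats0 big1// => i _; case: ifP => // /prefixP[s].
  by move=> /(congr1 size); rewrite size_cat size_rcons addSn => /eqP;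
     rewrite -[X in X == _]addn0 -addnS eqn_add2l.
have pE i : prefix (rcons u i) (u ++ j :: v') = (i == j).
  rewrite -cats1 prefixE size_cat take_cat ltnNge leq_addr/= addKn/= take0.
  by rewrite eqseq_cat// eqxx/= eqseq_cons andbT eq_sym.
under eq_bigr do rewrite pE.
case: (boolP (j \in A)) => [jA|jA].
  rewrite (bigD1_seq j)//= eqxx big1 ?addr0// => i.
  by move=> /negbTE->.
rewrite big_seq_cond big1 // => i /andP[iA _].
by case: eqP => // ij; rewrite -ij iA in jA.
Qed.

(** Let [mu] be the product weight of a word and [S u] the total weight of those [tau k] that extend
    [u]. Passing from [u] to its children does not decrease [mu] in total and does not increase [S],
    so some child inherits [S u < mu u]. Following such children gives [b]; a [tau k] on this branch
    would contribute its own weight [mu (tau k)] to [S (tau k)], a contradiction. *)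
Lemma exists_word_avoiding A a (tau : nat -> seq W) : uniq A ->
  (forall i, 0 < a i) -> 1 <= \sum_(i <- A) a i ->
  (\sum_(0 <= k <oo) (\prod_(i <- tau k) a i)%:E < 1)%E ->
  exists b : nat -> W, (forall n, b n \in A) /\
    forall k, tau k <> mkseq b (size (tau k)).
Proof.
move=> uA a0 a1 tau1; pose mu (u : seq W) : R := \prod_(i <- u) a i.
have mu0 u : 0 < mu u by apply: prodr_gt0.
pose f u k : \bar R := (if prefix u (tau k) then mu (tau k) else 0)%:E.
have f0 u k : (0 <= f u k)%E.
  by rewrite /f lee_fin; case: ifP => // _; exact: ltW.
pose S u : \bar R := (\sum_(0 <= k <oo) f u k)%E.
have step u : (S u < (mu u)%:E)%E ->
    exists2 i, i \in A & (S (rcons u i) < (mu (rcons u i))%:E)%E.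
  move=> Su; apply: contrapT => noi.
  have : ((mu u)%:E <= S u)%E; last by rewrite leNgt Su.
  have le1 : ((mu u)%:E <= \sum_(i <- A) S (rcons u i))%E.
    apply: (@le_trans _ _ (\sum_(i <- A) (mu (rcons u i))%:E)%E).
      rewrite sumEFin lee_fin.
      have muE i : mu (rcons u i) = mu u * a i by rewrite /mu big_rcons.
      under eq_bigr do rewrite muE.
      by rewrite -mulr_sumr ler_peMr// ltW// mu0.
    rewrite big_seq [leRHS]big_seq; apply: lee_sum => i iA.
    by rewrite leNgt; apply/negP => ?; apply: noi; exists i.
  apply: (le_trans le1); rewrite /S -nneseries_sum; last by move=> *; exact: f0.
  apply: lee_nneseries => [k _ _|k _]; first by apply: sume_ge0 => i _; exact: f0.
  by rewrite /f sumEFin lee_fin sum_prefix_rcons_le// ltW.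
have /choice[g gP] : forall u, exists i, (S u < (mu u)%:E)%E ->
    i \in A /\ (S (rcons u i) < (mu (rcons u i))%:E)%E.
  move=> u; have [Su|Su] := pselect (S u < (mu u)%:E)%E.
    by have [j] := step _ Su; exists j.
  suff [j] : exists j : W, True by exists j.
  case: (A) a1 => [|i s _]; last by exists i.
  by rewrite big_nil ler10.
pose v n := iter n (fun u => rcons u (g u)) [::].
have vP n : (S (v n) < (mu (v n))%:E)%E.
  elim: n => [|n IH] /=; last by have [] := gP _ IH.
  rewrite /mu big_nil; apply: le_lt_trans tau1; apply: lee_nneseries => // k _.
  by rewrite /f prefix0s.
pose b n := g (v n).
have bv n : mkseq b n = v n.
  by elim: n => // n IH; rewrite mkseqS IH.
exists b; split => [n|k tk].
  by have [] := gP _ (vP n).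
have := vP (size (tau k)); rewrite -bv -tk ltNge => /negP; apply.
rewrite /S (nneseriesD1 (n := k)) //.
apply: (@le_trans _ _ (f (tau k) k)); first by rewrite /f prefix_refl.
by apply: leeDl; apply: nneseries_ge0.
Qed.

Lemma powR_prod (s : seq W) l (t : R) : (forall i, 0 <= l i) ->
  \prod_(i <- s) l i `^ t = (\prod_(i <- s) l i) `^ t.
Proof.
move=> l0; elim: s => [|i s IH]; first by rewrite !big_nil powR1.
by rewrite !big_cons IH powRM ?prodr_ge0.
Qed.

(* A set of the cover is replaced by the deepest cylinder containing it: if it
   meets two children of that cylinder, separation bounds its diameter below
   by [delta] times the size of the cylinder. *)
Lemma cover_ge_of_separated (m : nat) A l (t delta kappa : R)
    (pt : (nat -> W) -> 'rV[R]_m) (V : nat -> set 'rV[R]_m) :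
  uniq A -> 0 < t -> 0 < delta -> kappa < 1 -> (forall i, 0 < l i) ->
  (forall i, i \in A -> l i <= kappa) -> 1 <= \sum_(i <- A) l i `^ t ->
  (forall (b b' : nat -> W) n, (forall n, b n \in A) -> (forall n, b' n \in A) ->
     mkseq b n = mkseq b' n -> b n <> b' n ->
     delta * \prod_(i <- mkseq b n) l i <= enorm (pt b - pt b')) ->
  (forall b : nat -> W, (forall n, b n \in A) -> exists k, V k (pt b)) ->
  ((delta `^ t / 2)%:E <= \sum_(0 <= k <oo) hweight t (V k))%E.
Proof.
move=> uA t0 d0 k1 l0 lk a1 sep cov; rewrite leNgt; apply/negP => small.
have [i0 i0A] : exists i0, i0 \in A.
  case: (A) a1 => [|i s _]; last by exists i; rewrite mem_head.
  by rewrite big_nil ler10.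
have k0 : 0 < kappa by apply: lt_le_trans (lk _ i0A); exact: l0.
have dt0 : 0 < delta `^ t by exact: powR_gt0.
pose inA (b : nat -> W) := forall n, b n \in A.
have prod_le b n : inA b -> \prod_(i <- mkseq b n) l i <= kappa ^+ n.
  move=> bA; elim: n => [|n IH]; first by rewrite big_nil expr0.
  rewrite mkseqS -cats1 big_cat/= big_seq1 exprSr ler_pM ?prodr_ge0//.
  - by move=> *; exact: ltW.
  - exact: ltW.
  - exact: lk.
(* The error term serves the sets whose coded points all share their first [n] letters, or that
   contain none: their weight may vanish, so they get a long word of small mass. The errors add up
   to 1/2 and the assumption [small] keeps the rest below 1/2, as [exists_word_avoiding]
   requires. *)
have tauP k : exists tau : seq W,
    ((\prod_(i <- tau) l i `^ t)%:E <=
      (delta `^ t)^-1%:E * hweight t (V k) + (2^-1 / (2 ^ k.+1)%:R)%:E)%E /\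
    forall b, inA b -> V k (pt b) -> tau = mkseq b (size tau).
  have [b [bA bV]] : exists b, inA b /\
      ((exists b', inA b' /\ V k (pt b')) -> V k (pt b)).
    have [[b [bA bV]]|nb] := pselect (exists b', inA b' /\ V k (pt b')).
      by exists b.
    by exists (fun=> i0); split.
  have e0 : 0 < (2^-1 / (2 ^ k.+1)%:R : R).
    by rewrite divr_gt0// ltr0n expn_gt0.
  have [n nP] : exists n, \prod_(i <- mkseq b n) l i `^ t <= 2^-1 / (2 ^ k.+1)%:R.
    have e1 : 0 < (2^-1 / (2 ^ k.+1)%:R : R) `^ t^-1 by exact: powR_gt0.
    have /cvgrPdist_lt/(_ _ e1)[n _ /(_ n (leqnn n))/=] :
        (kappa ^+ n @[n --> \oo] --> (0 : R)).
      by apply: cvg_expr; rewrite gtr0_norm.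
    rewrite sub0r normrN ger0_norm ?exprn_ge0 ?(ltW k0)// => kn.
    exists n; rewrite powR_prod; last by move=> ?; exact: ltW.
    have -> : 2^-1 / (2 ^ k.+1)%:R = ((2^-1 / (2 ^ k.+1)%:R : R) `^ t^-1) `^ t.
      by rewrite -powRrM mulVf ?gt_eqF// powRr1// ltW.
    apply: ge0_ler_powR; rewrite ?nnegrE ?powR_ge0 ?(ltW t0)//.
      by apply: prodr_ge0 => i _; exact: ltW.
    exact: le_trans (prod_le _ _ bA) (ltW kn).
  have [agree|] :=
    pselect (forall b', inA b' -> V k (pt b') -> mkseq b n = mkseq b' n).
    exists (mkseq b n); split; last by move=> c ? ?; rewrite size_mkseq;
      exact: agree.
    apply: (@le_trans _ _ (2^-1 / (2 ^ k.+1)%:R)%:E); first by rewrite lee_fin.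
    by apply: leeDr; rewrite mule_ge0 ?hweight_ge0// lee_fin invr_ge0 powR_ge0.
  move=> dis; pose D j := `[< exists b', [/\ inA b', V k (pt b') &
    mkseq b j <> mkseq b' j] >].
  have exD : exists j, D j.
    apply: contrapT => nD; apply: dis => b' bA' bV'; apply: contrapT => nbb'.
    by apply: nD; exists n; apply/asboolP; exists b'.
  case: (ex_minnP exD) => -[/asboolP[b' [_ _]]//|j] /asboolP[b' [bA' bV' bb']] min.
  have agree c : inA c -> V k (pt c) -> mkseq b j = mkseq c j.
    move=> cA cV; apply: contrapT => bc; have := min j; rewrite ltnn => /implyP.
    by rewrite implybF => /negP; apply; apply/asboolP; exists c.
  exists (mkseq b j); split; last by move=> c ? ?; rewrite size_mkseq; exact: agree.
  have bj : b j <> b' j.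
    by move=> bj; apply: bb'; rewrite !mkseqS bj (agree b').
  have dle := sep _ _ _ bA bA' (agree _ bA' bV') bj.
  have Vb : V k (pt b) by apply: bV; exists b'.
  have /(fun h => le_trans h (diam_ge Vb bV')) dle' :
      ((delta * \prod_(i <- mkseq b j) l i)%:E <= (enorm (pt b - pt b'))%:E)%E.
    by rewrite lee_fin.
  have pr0 : 0 <= \prod_(i <- mkseq b j) l i.
    by apply: prodr_ge0 => i _; exact: ltW.
  have hw : ((delta `^ t * \prod_(i <- mkseq b j) l i `^ t)%:E <= hweight t (V
    k))%E.
    rewrite /hweight; case: ifPn => [/eqP Vk0|_]; first by move: Vb; rewrite Vk0.
    rewrite powR_prod; last by move=> ?; exact: ltW.
    rewrite -powRM ?(ltW d0)// -poweR_EFin.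
    apply: gt0_ler_poweR => //; first exact: ltW.
      by rewrite in_itv/= leey lee_fin mulr_ge0// ltW.
    by rewrite in_itv/= leey (le_trans _ dle')// lee_fin mulr_ge0// ltW.
  apply: (@le_trans _ _ ((delta `^ t)^-1%:E * hweight t (V k))%E); last first.
    by apply: leeDl; rewrite lee_fin ltW.
  apply: le_trans (lee_wpmul2l _ hw); last by rewrite lee_fin invr_ge0 ltW.
  by rewrite -EFinM mulKf// gt_eqF.
move: tauP => /choice[tau tauP].
have [|b [bA nb]] := exists_word_avoiding (tau := tau) uA
    (fun i => powR_gt0 t (l0 i)) a1.
  apply: (@le_lt_trans _ _ (\sum_(0 <= k <oo) ((delta `^ t)^-1%:E *
      hweight t (V k) + (2^-1 / (2 ^ k.+1)%:R)%:E))%E).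
    apply: lee_nneseries => [k _ _|k _]; last by have [] := tauP k.
    by rewrite lee_fin; apply: prodr_ge0 => i _; exact: powR_ge0.
  apply: (le_lt_trans (epsilon_trick _ _ _)) => //.
    by move=> k; rewrite mule_ge0 ?hweight_ge0// lee_fin invr_ge0 powR_ge0.
  rewrite nneseriesZl; last by move=> *; exact: hweight_ge0.
  have : ((delta `^ t)^-1%:E * \sum_(0 <= i <oo) hweight t (V i) < (2^-1)%:E)%E.
    have -> : (2^-1)%:E = ((delta `^ t)^-1%:E * (delta `^ t / 2)%:E)%E.
      by rewrite -EFinM mulKf// gt_eqF.
    by rewrite lte_pmul2l// lte_fin invr_gt0.
  move=> lt; rewrite (_ : 1%E = (2^-1)%:E + (2^-1)%:E)%E; last first.
    by rewrite -EFinD; congr EFin; lra.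
  by apply: lte_leD.
have [k Vk] := cov b bA.
by apply: (nb k); have [_] := tauP k; apply.
Qed.

End PrefixAvoidance.

(** * Sums over words *)

Section Words.
Variable I : eqType.
Implicit Types (A C : seq I) (w : seq I) (n : nat).

Fixpoint words A n : seq (seq I) :=
  if n is k.+1 then [seq i :: w | i <- A, w <- words A k] else [:: [::]].

Lemma mem_words A n w :
  (w \in words A n) = (size w == n) && all [in A] w.
Proof.
elim: n w => [|n IH] [|i w] //=.
  by apply/allpairsP => -[[j v] [_ _ /=]].
apply/allpairsP/idP => [[[j v] /= [jA vA [-> ->]]]|].
  by move: vA; rewrite IH eqSS => /andP[-> ->]; rewrite jA.
by rewrite eqSS => /andP[sw /andP[iA wA]]; exists (i, w); rewrite IH sw.
Qed.

Lemma words_uniq A n : uniq A -> uniq (words A n).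
Proof.
move=> uA; elim: n => //= n IH; apply: allpairs_uniq => //.
by move=> [i w] [j v] _ _ /= [-> ->].
Qed.

Lemma words1 A : words A 1 = [seq [:: i] | i <- A].
Proof. by rewrite /= /allpairs; elim: A => //= i A ->. Qed.

Variable R : realType.
Implicit Type F : seq I -> R.

Lemma sum_wordsS A n F :
  \sum_(w <- words A n.+1) F w = \sum_(i <- A) \sum_(w <- words A n) F (i :: w).
Proof. by rewrite big_allpairs_dep. Qed.

Lemma sum_wordsD A n p F :
  \sum_(w <- words A (n + p)) F w =
    \sum_(u <- words A n) \sum_(v <- words A p) F (u ++ v).
Proof.
elim: n F => [|n IH] F; first by rewrite big_seq1.
by rewrite addSn !sum_wordsS; apply: eq_bigr => i _; rewrite IH.
Qed.

(* The words of length [k] over [A ++ C] are split according to their first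
   letter in [C]. *)
Lemma sum_first_exit_le A C k F : (forall w, 0 <= F w) ->
  \sum_(j < k) \sum_(v <- words A j) \sum_(i <- C)
     \sum_(w <- words (A ++ C) (k - j.+1)) F (v ++ i :: w) <=
  \sum_(w <- words (A ++ C) k) F w.
Proof.
elim: k F => [|k IH] F F0; first by rewrite big_ord0 big_seq1.
rewrite sum_wordsS big_cat/= big_ord_recl/= big_seq1 subn1/= addrC lerD//.
under eq_bigr => j _ do rewrite sum_wordsS subSS.
by rewrite exchange_big/=; apply: ler_sum => i _; exact: IH.
Qed.

(** [ws] may repeat elements, which only enlarges its sum. The induction removes one occurrence from
    [ws] for each matched element of [r]. *)
Lemma sum_uniq_le (T : eqType) (r ws : seq T) (g : T -> R) : uniq r ->
  (forall x, 0 <= g x) -> (forall x, x \in r -> x \notin ws -> g x = 0) ->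
  \sum_(x <- r) g x <= \sum_(x <- ws) g x.
Proof.
move=> ur g0; elim: r ws ur => [|x r IH] ws /=.
  by move=> _ _; rewrite big_nil sumr_ge0.
move=> /andP[xr ur] gz; rewrite big_cons.
have [xws|xws] := boolP (x \in ws); last first.
  rewrite gz ?mem_head// add0r; apply: IH => // y yr; apply: gz.
  by rewrite in_cons yr orbT.
rewrite [leRHS](big_rem x xws)/= lerD2l; apply: IH => // y yr yws.
apply: gz; first by rewrite in_cons yr orbT.
apply: contra yws; apply: rem_mem.
by apply: contraNneq xr => <-.
Qed.
End Words.

(** This reads a sequence over the alphabet of words of length [n] as a sequence of letters, so that
    limit points of a system of blocks belong to the original limit set. *)
Lemma exists_block_coding (I : Type) (b : nat -> seq I) n : (0 < n)%N ->
  (forall k, size (b k) = n) ->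
  exists w : nat -> I, forall k, mkseq w (k * n) = flatten (mkseq b k).
Proof.
move=> n0 bn; have i0 : I by case: (b 0%N) (bn 0%N) n0 => //= <-.
have sz k : size (flatten (mkseq b k)) = (k * n)%N.
  by elim: k => // k IH;
    rewrite mkseqS -cats1 flatten_cat size_cat/= cats0 IH bn mulSnr.
have fl k p : (k <= p)%N -> exists v, flatten (mkseq b p) = flatten (mkseq b k)
  ++ v.
  move=> kp; rewrite -(subnKC kp) /mkseq iotaD map_cat flatten_cat.
  by eexists.
(* Since [n] is positive, the first [i.+1] blocks have more than [i] letters, so the default [i0] is
   never read. *)
exists (fun i => nth i0 (flatten (mkseq b i.+1)) i) => k.
apply: (@eq_from_nth _ i0); rewrite size_mkseq ?sz// => i ik.
rewrite nth_mkseq//.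
have i1 : (i < i.+1 * n)%N by rewrite (leq_trans (ltnSn i))// leq_pmulr.
have [ki|ik'] := leqP k i.+1.
  by have [v ->] := fl _ _ ki; rewrite nth_cat sz ik.
by have [v ->] := fl _ _ (ltnW ik'); rewrite nth_cat sz i1.
Qed.

(** * Elementary facts on real powers and sequences *)

Section RealSequences.
Variable R : realType.

Lemma common_lower_bound (U : eqType) (r : seq U) (Q : U -> R -> Prop) :
  (forall p d d', Q p d -> d' <= d -> Q p d') ->
  (forall p, p \in r -> exists2 d, 0 < d & Q p d) ->
  exists2 d, 0 < d & forall p, p \in r -> Q p d.
Proof.
move=> Qmono; elim: r => [|p r IH] Qr; first by exists 1.
have [|d d0 dr] := IH; first by move=> q qr; apply: Qr; rewrite in_cons qr orbT.
have [d' d'0 d'p] := Qr p (mem_head _ _).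
exists (Num.min d d'); first by rewrite lt_min d0.
move=> q; rewrite in_cons => /predU1P[->|/dr].
  by move/Qmono: d'p; apply; rewrite ge_min lexx orbT.
by move/Qmono; apply; rewrite ge_min lexx.
Qed.

(** A finite sum is continuous in its exponent, so a strict inequality survives a small increase of
    [h]. This is why the supercritical case is treated over a finite alphabet. *)
Lemma powR_sum_gt1 (U : Type) (r : seq U) (l : U -> R) (h : R) :
  (forall u, 0 < l u) -> 1 < \sum_(u <- r) l u `^ h ->
  exists2 t, h < t & 1 < \sum_(u <- r) l u `^ t.
Proof.
move=> l0 gt1.
have cont : (\sum_(u <- r) l u `^ t) @[t --> h] --> \sum_(u <- r) l u `^ h.
  elim: (r) => [|u r' IH].
    by under eq_fun do rewrite big_nil; rewrite big_nil; exact: cvg_cst.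
  under eq_fun do rewrite big_cons; rewrite big_cons; apply: cvgD IH.
  have lE t : l u `^ t = expR (t * ln (l u)) by rewrite /powR gt_eqF.
  rewrite lE (_ : powR (l u) = fun t => expR (t * ln (l u))); last exact/funext.
  apply: (@cvg_comp _ _ _ (fun t => t * ln (l u)) expR _ (nbhs (h * ln (l u)))).
    exact: mulrr_continuous.
  exact: continuous_expR.
have /nbhs_ballP[e /= e0 He] : \forall t \near h, 1 < \sum_(u <- r) l u `^ t.
  exact: (cvgr_gt _ cont).

exists (h + e / 2); first by rewrite ltrDl divr_gt0.
apply: He; rewrite /ball/= opprD addrA subrr add0r normrN gtr0_norm ?divr_gt0//.
by rewrite ltr_pdivrMr// ltr_pMr// ltr1n.
Qed.

Lemma exists_nat_powR_ge (p B : R) (L : nat) : 0 < p ->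
  exists2 N, (L < N)%N & B <= N%:R `^ p.
Proof.
move=> p0; pose x := `|B| `^ p^-1.
exists (Num.truncn x + L).+1; first by rewrite ltnS leq_addl.
apply: le_trans (ler_norm _) _.
have -> : `|B| = x `^ p by rewrite /x -powRrM mulVf ?gt_eqF// powRr1.
apply: ge0_ler_powR; rewrite ?nnegrE ?powR_ge0 ?(ltW p0)//.
apply: (@le_trans _ _ (Num.truncn x).+1%:R); first exact/ltW/truncnS_gt.
by rewrite ler_nat ltnS leq_addr.
Qed.

Lemma exists_small_term (u : nat -> R) (G e : R) : 0 < e ->
  (forall k, \sum_(j < k) u j <= G) -> exists k, u k <= e.
Proof.
move=> e0 uG; apply: contrapT => nk.
have ue k : e <= u k by rewrite leNgt; apply/negP => /ltW uk; apply: nk; exists k.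
have [N N0 GN] := @exists_nat_powR_ge 1 ((G + 1) / e) 0 ltr01.
have := uG N; rewrite leNgt => /negP; apply.
apply: (@lt_le_trans _ _ (\sum_(j < N) e)); last by apply: ler_sum.
rewrite sumr_const card_ord -mulr_natl -ltr_pdivrMr//.
rewrite powRr1// in GN; apply: lt_le_trans GN.
by rewrite ltr_pM2r ?invr_gt0// ltrDl.
Qed.

End RealSequences.

(** * Systems with quasi-multiplicative word ratios *)

Section InfiniteSystem.
Variables (R : realType) (m T : nat).
Local Notation E := 'rV[R]_m.
Local Notation I := (nat * 'I_T)%type.
Variables (s : I -> E -> E) (X : set E) (a b : E) (K M c gamma t1 : R) (L : nat).
Let word := word_map s.
Let rho w := enorm (word w a - word w b).
Let J := limit_set X s.

Hypothesis T_gt0 : (0 < T)%N.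
Hypothesis K_ge1 : 1 <= K.
Hypothesis c_gt0 : 0 < c.
Hypothesis t1_gt0 : 0 < t1.
Hypothesis gt1_lt1 : gamma * t1 < 1.
Hypothesis L_gt0 : (0 < L)%N.
Hypothesis gamma_gt0 : 0 < gamma.
Hypothesis M_ge0 : 0 <= M.
Hypothesis X_compact : compact X.
Hypothesis X_diam : forall x y, X x -> X y -> enorm (x - y) <= 2.
Hypothesis Xa : X a.
Hypothesis Xb : X b.
Hypothesis ab1 : enorm (a - b) = 1.
Hypothesis s_stable : forall i x, X x -> X (s i x).
Hypothesis word_closed : forall w, closed (word w @` X).
Hypothesis rho_gt0 : forall w, 0 < rho w.
Hypothesis word_lower : forall w x y, X x -> X y ->
  rho w / K * enorm (x - y) <= enorm (word w x - word w y).
Hypothesis word_upper : forall w x y, X x -> X y ->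
  enorm (word w x - word w y) <= K * rho w * enorm (x - y).
Hypothesis contraction : forall i, K * rho [:: i] <= 2^-1.
Hypothesis gap : forall i j, i <> j ->
  exists2 d : R, 0 < d & forall x y, X x -> X y -> d <= enorm (s i x - s j y).
Hypothesis tail_le : forall N i x y j, (0 < N)%N -> (N <= i.1)%N ->
  (N <= j.1)%N -> X x -> X y ->
  enorm (s i x - s j y) <= M * N%:R `^ (- gamma).
Hypothesis rho_ge : forall N i, (L <= N)%N -> (i.1 < N + N)%N ->
  c * N%:R `^ (- gamma) * N%:R `^ (- gamma) <= rho [:: i].

Let letters p q : seq I := [seq (n, j) | n <- iota p q, j <- enum 'I_T].

(** By quasi-multiplicativity each further letter then at least halves the sum at exponent [t1]. So
    [J] has measure 0 at [t1] and its dimension is at most [t1]. *)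
Hypothesis first_level : forall N,
  \sum_(i <- letters 0 N) rho [:: i] `^ t1 <= 2^-1 / K `^ t1.

Let Z A t n := \sum_(w <- words A n) rho w `^ t.

Let K_gt0 : 0 < K. Proof. exact: lt_le_trans ltr01 K_ge1. Qed.

Let K_ge0 : 0 <= K. Proof. exact: ltW. Qed.

Let rho_ge0 w : 0 <= rho w. Proof. exact: ltW. Qed.

Let word_cat u v x : word (u ++ v) x = word u (word v x).
Proof. by rewrite /word /word_map; elim: u => //= i u ->. Qed.

Let word_stable w x : X x -> X (word w x).
Proof. by move=> Xx; elim: w => //= i w IH; exact: s_stable. Qed.

Let rho_nil : rho [::] = 1. Proof. exact: ab1. Qed.

Let rho_cat_le u v : rho (u ++ v) <= K * rho u * rho v.
Proof. by rewrite /rho !word_cat word_upper//; exact: word_stable. Qed.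

Let rho_cat_ge u v : rho u * rho v <= K * rho (u ++ v).
Proof.
rewrite -ler_pdivrMl// mulrA [_^-1 * _]mulrC /rho !word_cat.
by apply: word_lower; exact: word_stable.
Qed.

Let Kt t := K `^ t.

Let Kt_ge1 t : 0 <= t -> 1 <= Kt t.
Proof. by move=> t0; rewrite /Kt -(powRr0 K); exact: ler_powR. Qed.

Let rt_cat_le t u v : 0 <= t ->
  rho (u ++ v) `^ t <= Kt t * (rho u `^ t * rho v `^ t).
Proof.
move=> t0; rewrite -powRM ?K_ge0 ?rho_ge0// -powRM ?mulr_ge0 ?K_ge0 ?rho_ge0//.
by apply: ge0_ler_powR; rewrite ?nnegrE ?mulr_ge0 ?K_ge0 ?rho_ge0// mulrA.
Qed.

Let rt_cat_ge t u v : 0 <= t ->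
  rho u `^ t * rho v `^ t <= Kt t * rho (u ++ v) `^ t.
Proof.
move=> t0; rewrite -powRM ?K_ge0 ?rho_ge0// -powRM ?K_ge0 ?rho_ge0//.
by apply: ge0_ler_powR; rewrite ?nnegrE ?mulr_ge0 ?K_ge0 ?rho_ge0.
Qed.

Let Z_ge0 A t n : 0 <= Z A t n.
Proof. by apply: sumr_ge0 => *; exact: powR_ge0. Qed.

Let ZS_le A t n : 0 <= t -> Z A t n.+1 <= Kt t * (Z A t 1 * Z A t n).
Proof.
move=> t0; rewrite /Z -add1n sum_wordsD big_distrl/= mulr_sumr.
apply: ler_sum => u _; rewrite !mulr_sumr; apply: ler_sum => v _.
exact: rt_cat_le.
Qed.

(** The two factors [Kt t] pay for cutting [v ++ i :: w] before and after the letter [i]. *)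
Let first_exit A C t k : 0 <= t ->
  \sum_(j < k) Z A t j * (\sum_(i <- C) rho [:: i] `^ t) *
     Z (A ++ C) t (k - j.+1) <= Kt t * Kt t * Z (A ++ C) t k.
Proof.
move=> t0; rewrite /Z [leRHS]mulr_sumr.
apply: le_trans (sum_first_exit_le A C k _); last first.
  by move=> w; rewrite !mulr_ge0 ?powR_ge0.
apply: ler_sum => j _; rewrite -mulrA mulr_suml; apply: ler_sum => v _.
rewrite mulr_suml mulr_sumr; apply: ler_sum => i _.
rewrite !mulr_sumr; apply: ler_sum => w _.
apply: (@le_trans _ _ (Kt t * (rho v `^ t * rho (i :: w) `^ t))).
  rewrite [leRHS]mulrCA ler_wpM2l ?powR_ge0//.
  exact: (rt_cat_ge [:: i] w t0).
by rewrite -mulrA ler_wpM2l ?powR_ge0//; exact: rt_cat_ge.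
Qed.

Let contract w x y : X x -> X y ->
  enorm (word w x - word w y) <= 2^-1 ^+ size w * enorm (x - y).
Proof.
move=> Xx Xy; elim: w => [|i w IH]; first by rewrite expr0 mul1r.
apply: le_trans (word_upper [:: i] (word_stable w Xx) (word_stable w Xy)) _.
rewrite /= exprS -[leRHS]mulrA; apply: ler_pM.
- by rewrite mulr_ge0.
- exact: enorm_ge0.
- exact: contraction.
- exact: IH.
Qed.

(** * Coding of limit points, and covers by cylinders *)

(** The points [f p] with [p >= n] all lie in the image of level [n], which is closed, so a cluster
    point of [f] lies in every image. *)
Let limit_pointP w : exists x, forall n, (word (mkseq w n) @` X) x.
Proof.
pose f n := word (mkseq w n) a.
have anti n p : (n <= p)%N -> (word (mkseq w n) @` X) (f p).
  move=> np; rewrite /f -(subnK np) addnC /mkseq iotaD map_cat word_cat.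
  by eexists; [|reflexivity]; exact: word_stable.
have /X_compact[] : (f @ \oo) X.
  by exists 0%N => // n _; exact: word_stable.
move=> x [Xx fx]; exists x => n; apply: word_closed => B Bx.
apply: fx => //; exists n => // p; exact: anti.
Qed.

(** [limit_set] only speaks of levels [N >= 1]; stability of [X] adds level 0, which covers by words
    of length 0 use. *)
Let limit_set_word x : J x -> exists w, forall n, (word (mkseq w n) @` X) x.
Proof.
move=> [w _ Jx]; exists w => -[|n]; last exact: Jx.
have [y Xy <-] := Jx 1%N isT; exists (s (w 0%N) y) => //.
exact: s_stable.
Qed.

Let mem_letters p q i : (i \in letters p q) = (p <= i.1 < p + q)%N.
Proof.
case: i => n j; apply/allpairsP/idP => [[[n' j'] /= [nI _ [-> _]]]|npq].
  by rewrite -mem_iota.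
by exists (n, j); rewrite mem_iota mem_enum.
Qed.

Let letters_uniq p q : uniq (letters p q).
Proof.
apply: allpairs_uniq; rewrite ?iota_uniq ?enum_uniq//.
by move=> [n j] [n' j'] _ _ /= [-> ->].
Qed.

Let letters_cat p q r : letters p (q + r) = letters p q ++ letters (p + q) r.
Proof. by rewrite /letters iotaD allpairs_cat. Qed.

Let Z_mono N N' t n : (N <= N')%N -> Z (letters 0 N) t n <= Z (letters 0 N') t n.
Proof.
move=> NN'; apply: sum_uniq_le => [|w|w wN].
- exact/words_uniq/letters_uniq.
- exact: powR_ge0.
- rewrite mem_words in wN; move: wN => /andP[/eqP sw /allP wN] /negP[].
  rewrite mem_words sw eqxx; apply/allP => i /wN.
  by rewrite /= !mem_letters/= !add0n => /leq_trans; exact.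
Qed.

Let word_hweight w t d (U : set E) : 0 <= t -> 0 <= d -> U `<=` X ->
  (forall x y, U x -> U y -> enorm (x - y) <= d) ->
  (hweight t (word w @` U) <= ((K * d) `^ t * rho w `^ t)%:E)%E.
Proof.
move=> t0 d0 UX Ud; rewrite -powRM ?mulr_ge0 ?K_ge0 ?rho_ge0//.
apply: hweight_le => //; first by rewrite !mulr_ge0 ?K_ge0 ?rho_ge0.
move=> _ _ [x Ux <-] [y Uy <-].
apply: le_trans (word_upper _ (UX _ Ux) (UX _ Uy)) _.
rewrite mulrAC ler_wpM2r ?rho_ge0// ler_wpM2l ?K_ge0//.
exact: Ud.
Qed.

(** The cover consists of all cylinders of level [n], over the infinite alphabet. A finite family of
    words uses only letters of some [letters 0 N], hence a bound uniform in [N]. *)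
Let level_cover t n (B : R) : 0 <= t -> (forall N, Z (letters 0 N) t n <= B) ->
  exists V : nat -> set E, J `<=` \bigcup_k V k /\
    (\sum_(0 <= k <oo) hweight t (V k) <= ((K * 2) `^ t * B)%:E)%E.
Proof.
move=> t0 ZB; pose U (w : seq I) := if size w == n then word w @` X else set0.
apply: (@countable_cover _ _ _ U).
  move=> x /limit_set_word[w wx]; exists (mkseq w n) => //.
  by rewrite /U size_mkseq eqxx.
move=> r ur.
have [N rN] : exists N, forall w, w \in r -> all [in letters 0 N] w.
  elim: (r) => [|w r' [N IH]]; first by exists 0%N.
  have [N' wN'] : exists N', all [in letters 0 N'] w.
    elim: (w) => [|i w' [N' IH']]; first by exists 0%N.
    exists (maxn N' i.1.+1); rewrite /= mem_letters/= add0n leq_maxr/=.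
    apply: sub_all IH' => j; rewrite /= !mem_letters/= !add0n => /leq_trans; apply.
    exact: leq_maxl.
  exists (maxn N N') => v; rewrite in_cons => /predU1P[->|/IH].
    apply: sub_all wN' => j; rewrite /= !mem_letters/= !add0n => /leq_trans; apply.
    exact: leq_maxr.
  apply: sub_all => j; rewrite /= !mem_letters/= !add0n => /leq_trans; apply.
  exact: leq_maxl.
pose g w := if size w == n then (K * 2) `^ t * rho w `^ t else 0.
have g0 w : 0 <= g w by rewrite /g; case: ifP; rewrite ?mulr_ge0 ?powR_ge0.
apply: (@le_trans _ _ (\sum_(w <- r) (g w)%:E)%E).
  apply: lee_sum => w _; rewrite /g /U; case: ifP => _;
    last by rewrite hweight_set0.
  by apply: word_hweight.
rewrite sumEFin lee_fin.
apply: (@le_trans _ _ (\sum_(w <- words (letters 0 N) n) g w)).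
  apply: sum_uniq_le => // w wr; rewrite mem_words rN// andbT /g.
  by move=> /negbTE->.
apply: le_trans (ler_wpM2l (powR_ge0 _ _) (ZB N)).
rewrite /Z mulr_sumr [leLHS]big_seq [leRHS]big_seq; apply: ler_sum => w.
by rewrite mem_words /g => /andP[-> _].
Qed.

(* A point whose coding leaves the alphabet [letters 0 N] before time [k] lies
   in the image of the tail [\bigcup_(i.1 >= N) s i X], which is small. *)
Let exit_cover t N k : 0 <= t -> (0 < N)%N ->
  exists V : nat -> set E, J `<=` \bigcup_k V k /\
    (\sum_(0 <= k <oo) hweight t (V k) <=
      ((K * 2) `^ t * Z (letters 0 N) t k +
       (K * (M * N%:R `^ (- gamma))) `^ t *
          \sum_(j < k) Z (letters 0 N) t j)%:E)%E.
Proof.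
move=> t0 N0; set A := letters 0 N; set d := M * _.
have d0 : 0 <= d by rewrite mulr_ge0 ?powR_ge0.
pose tail : set E := [set y | exists i x, [/\ (N <= i.1)%N, X x & y = s i x]].
(* A word of length [k] over [A] stands for the codings that have not left [A] by time [k]; a
   shorter one for those that leave [A] right after it. All other words get the empty set. *)
pose U (w : seq I) := if all [in A] w then
  (if size w == k then word w @` X else
   if (size w < k)%N then word w @` tail else set0) else set0.
apply: (@countable_cover _ _ _ U).
  move=> x /limit_set_word[w wx].
  have [wA|] := boolP (all [in A] (mkseq w k)).
    by exists (mkseq w k) => //; rewrite /U wA size_mkseq eqxx.
  move=> nA; have exj : exists j, w j \notin A.
    have /allPn[i /mapP[j _ ->] nj] := nA; by exists j.
  case: (ex_minnP exj) => j jA jmin.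
  have jk : (j < k)%N.
    have /allPn[i /mapP[p + ->] np] := nA.
    by rewrite mem_iota => /andP[_]; apply: leq_ltn_trans; exact: jmin.
  have wA : all [in A] (mkseq w j).
    apply/allP => i /mapP[p]; rewrite mem_iota => /andP[_ pj] ->.
    by apply: contraTT pj => /jmin; rewrite -leqNgt.
  exists (mkseq w j) => //; rewrite /U wA size_mkseq ltn_eqF// jk.
  have [y Xy <-] := wx j.+1; rewrite mkseqS -cats1 word_cat.
  exists (word [:: w j] y) => //; exists (w j), y; split=> //.
  by move: jA; rewrite mem_letters/= add0n -leqNgt.
move=> r ur.
pose ws := words A k ++ flatten [seq words A j | j <- index_iota 0 k].
pose g w := if w \in ws then
   (if size w == k then (K * 2) `^ t * rho w `^ t else (K * d) `^ t * rho w `^ t)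
     else 0.
have g0 w : 0 <= g w.
  by rewrite /g; case: ifP => // _; case: ifP; rewrite ?mulr_ge0 ?powR_ge0.
have tailX : tail `<=` X by move=> _ [i [x [_ Xx ->]]]; exact: s_stable.
apply: (@le_trans _ _ (\sum_(w <- r) (g w)%:E)%E).
  apply: lee_sum => w _; rewrite /g /U.
  case: ifPn => [wA|_]; last by rewrite hweight_set0 lee_fin; exact: (g0 w).
  have [/eqP sw|sw] := boolP (size w == k).
    by rewrite mem_cat mem_words sw eqxx wA/=; exact: word_hweight.
  case: ifPn => [swk|_]; last by rewrite hweight_set0 lee_fin; case: ifP => // _;
    rewrite mulr_ge0 ?powR_ge0.
  rewrite ifT; last first.
    rewrite mem_cat; apply/orP; right; apply/flattenP; exists (words A (size w)).
      by apply: map_f; rewrite mem_index_iota.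
    by rewrite mem_words eqxx.
  apply: word_hweight => // x y [i [x' [iN Xx' ->]]] [j [y' [jN Xy' ->]]].
  exact: tail_le.
rewrite sumEFin lee_fin.
apply: (@le_trans _ _ (\sum_(w <- ws) g w)).
  by apply: sum_uniq_le => // w _ /negbTE wws; rewrite /g wws.
rewrite [in leLHS]/ws big_cat/= big_flatten/= big_map big_mkord.
apply: lerD.
  rewrite /Z mulr_sumr [leLHS]big_seq [leRHS]big_seq; apply: ler_sum => w wk.
  by rewrite /g mem_cat wk; move: wk; rewrite mem_words => /andP[->].
rewrite mulr_sumr; apply: ler_sum => j _.
rewrite /Z mulr_sumr [leLHS]big_seq [leRHS]big_seq; apply: ler_sum => w.
rewrite mem_words => /andP[/eqP sw _]; rewrite /g sw ltn_eqF//.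
by case: ifP => // _; rewrite mulr_ge0 ?powR_ge0.
Qed.

(** * Separated subsystems over finite alphabets *)

(** Distinct words of equal length have a first differing letter, where [gap] applies. Each letter
    of the common prefix shrinks the gap by a factor of at least [rho [:: i] / K]. *)
Let word_gap w w' : size w = size w' -> w <> w' ->
  exists2 d : R, 0 < d & forall x y, X x -> X y -> d <= enorm (word w x - word w'
    y).
Proof.
elim: w w' => [|i w IH] [|j w'] //= [sw] neq.
have [eij|/gap[d d0 gd]] := pselect (i = j); last first.
  by exists d => // x y Xx Xy; apply: gd; exact: word_stable.
rewrite -{}eij in neq *; have [|d d0 gd] := IH w' sw; first by move=> eww;
  apply: neq; rewrite eww.
exists (rho [:: i] / K * d); first by rewrite mulr_gt0// divr_gt0.
move=> x y Xx Xy.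
apply: le_trans (word_lower [:: i] (word_stable w Xx) (word_stable w' Xy)).
by rewrite ler_wpM2l ?gd// divr_ge0.
Qed.

Let word_flatten_lower u x y : X x -> X y ->
  (\prod_(w <- u) (rho w / K)) * enorm (x - y) <=
    enorm (word (flatten u) x - word (flatten u) y).
Proof.
move=> Xx Xy; elim: u => [|w u IH] /=; first by rewrite big_nil mul1r.
rewrite big_cons -mulrA !word_cat.
apply: le_trans (word_lower w (word_stable _ Xx) (word_stable _ Xy)).
by rewrite ler_wpM2l ?IH// divr_ge0.
Qed.

(** The subsystem has the words of length [n] as letters, with ratios [l w = rho w / K]. Dividing by
    [K] makes the lower bounds on distances truly multiply along blocks, and turns the threshold
    [Kt h] into 1. *)
Let supercritical N n h : 0 <= h -> Kt h < Z (letters 0 N) h n ->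
  exists t c0, [/\ h < t, 0 < c0 & forall V : nat -> set E,
    J `<=` \bigcup_k V k -> (c0%:E <= \sum_(0 <= k <oo) hweight t (V k))%E].
Proof.
move=> h0 Zgt.
have n0 : (0 < n)%N.
  case: n Zgt => //; rewrite /Z /= big_seq1 rho_nil powR1 ltNge.
  by rewrite Kt_ge1.
pose A := words (letters 0 N) n; pose l w := rho w / K.
have l0 w : 0 < l w by rewrite divr_gt0.
have uA : uniq A by exact/words_uniq/letters_uniq.
have sA w : w \in A -> size w = n by rewrite mem_words => /andP[/eqP].
have l1 : 1 < \sum_(w <- A) l w `^ h.
  under eq_bigr => w _ do rewrite powRM ?rho_ge0 ?invr_ge0//.
  rewrite -mulr_suml -powR_inv1// -powRrM mulN1r powRN.
  by rewrite ltr_pdivlMr ?mul1r// powR_gt0.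
have [t ht lt1] := powR_sum_gt1 l0 l1.
have t0 : 0 < t by exact: le_lt_trans ht.
have [|p pA|d d0 gd] := @common_lower_bound R _ [seq (w, w') | w <- A, w' <- A]
  (fun p d => p.1 <> p.2 -> forall x y, X x -> X y ->
     d <= enorm (word p.1 x - word p.2 y)).
- by move=> p d d' dP dd' neq x y Xx Xy; apply: le_trans dd' _; exact: dP.
- have [e|ne] := pselect (p.1 = p.2); first by exists 1.
  have [|d d0 dP] := @word_gap p.1 p.2 _ ne; last by exists d.
  by move: pA => /allpairsP[[w w'] /= [wA w'A ->]] /=; rewrite !sA.
exists t, (d `^ t / 2); split=> //; first by rewrite divr_gt0// powR_gt0.
move=> V JV.
have /choice[pt ptP] : forall b : nat -> seq I, exists x, (forall k, b k \in A) ->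
    J x /\ forall k, (word (flatten (mkseq b k)) @` X) x.
  move=> u; have [uiA|nA] := pselect (forall k, u k \in A); last by exists a.
  have [|w wb] := @exists_block_coding _ u n n0; first by move=> k; exact: sA.
  have [x xw] := limit_pointP w; exists x => _; split.
    by exists w => // p _; exact: xw.
  by move=> k; rewrite -wb; exact: xw.
apply: (@cover_ge_of_separated _ _ _ A l t d 2^-1 pt) => //.
- by rewrite invf_lt1// ltr1n.
- move=> w wA; apply: (@le_trans _ _ (rho w)).
    by rewrite ler_pdivrMr// ler_peMr.
  apply: le_trans (contract w Xa Xb) _.
  rewrite ab1 mulr1 (sA w wA) -(prednK n0) exprS ler_piMr// exprn_ile1 ?invr_ge0//.
  by rewrite invf_le1// ler1n.
- exact: ltW.
- move=> u u' k uiA u'A uu' nuu'.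
  have [_ /(_ k.+1)[x Xx <-]] := ptP u uiA.
  have [_ /(_ k.+1)[y Xy <-]] := ptP u' u'A.
  rewrite !mkseqS -!cats1 !flatten_cat !word_cat -uu' mulrC.
  apply: le_trans (word_flatten_lower _ (word_stable _ Xx) (word_stable _ Xy)).
  rewrite ler_wpM2l//; first by apply: prodr_ge0 => w _; exact: ltW.
  apply: (gd (u k, u' k)) => //.
  by apply/allpairsP; exists (u k, u' k); split=> /=.
- by move=> u uiA; have [/JV[k _ Vk] _] := ptP u uiA; exists k.
Qed.

Lemma hausdorff_measure_hausdorff_dim_eq0 :
  hausdorff_measure (hausdorff_dim J) J = 0%E.
Proof.
pose D := [set t : R | 0 <= t /\ hausdorff_measure t J = 0%E].
have Dlb : has_lbound D by exists 0 => t [].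
have Dt1 : D t1.
  split; first exact: ltW.
  apply: hausdorff_measure_eq0 => // e e0.
  have Zt n N : Z (letters 0 N) t1 n <= 2^-1 ^+ n.
    elim: n => [|n IH]; first by rewrite /Z /= big_seq1 rho_nil powR1 expr0.
    apply: le_trans (ZS_le _ n (ltW t1_gt0)) _.
    rewrite mulrA exprS ler_pM// ?mulr_ge0 ?powR_ge0//.
    rewrite mulrC -ler_pdivlMr ?powR_gt0//.
    by rewrite /Z words1 big_map; exact: first_level.
  have [n nP] : exists n, (K * 2) `^ t1 * 2^-1 ^+ n <= e.
    have B0 : 0 < (K * 2) `^ t1 by rewrite powR_gt0// mulr_gt0.
    have e1 : 0 < e / (K * 2) `^ t1 by rewrite divr_gt0.
    have /cvgrPdist_lt/(_ _ e1)[n _ /(_ n (leqnn n))/=] :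
        ((2^-1 : R) ^+ n @[n --> \oo] --> (0 : R)).
      by apply: cvg_expr; rewrite gtr0_norm ?invr_gt0// invf_lt1// ltr1n.
    rewrite sub0r normrN ger0_norm ?exprn_ge0// ltr_pdivlMr// => /ltW.
    by rewrite mulrC; exists n.
  have [V [JV Vs]] := level_cover (ltW t1_gt0) (Zt n).
  by exists V; split=> //; apply: le_trans Vs _; rewrite lee_fin.
set h := hausdorff_dim J.
have h_ge0 : 0 <= h.
  by apply: lb_le_inf; [exists t1|move=> t []].
have h_le : h <= t1 by exact: ge_inf.
have critical N n : Z (letters 0 N) h n <= Kt h.
  rewrite leNgt; apply/negP => /(supercritical h_ge0)[t [c0 [ht c00 Vc0]]].
  (* The infimum [h] is not known to be attained, so an exponent [r] of [D] below [t] is used.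
     Covers by sets of diameter at most 1 weigh no more at [t] than at [r]. *)
  have [r [r0 Jr] rt] : exists2 r, D r & r < t.
    by apply: inf_lt ht; exists t1.
  have [V [JV Vd Vs]] := cover_lt_of_measure0 Jr ltr01 c00.
  have := Vc0 V JV; rewrite leNgt => /negP; apply; apply: le_lt_trans Vs.
  apply: lee_nneseries => [k _ _|k _]; first exact: hweight_ge0.
  exact: hweight_antitone.
(* At exponent 0 every letter counts 1, and two letters already exceed [Kt 0 = 1]. Positivity is
   what [hausdorff_measure_eq0] asks for. *)
have h_gt0 : 0 < h.
  rewrite lt_neqAle h_ge0 andbT eq_sym; apply/eqP => h0.
  have := critical 2%N 1%N; rewrite /Kt h0 powRr0 /Z words1 big_map.
  under eq_bigr do rewrite powRr0.
  rewrite leNgt => /negP; apply; pose j0 := Ordinal T_gt0.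
  apply: (@lt_le_trans _ _ (\sum_(i <- [:: (0%N, j0); (1%N, j0)]) (1 : R))).
    by rewrite big_cons big_seq1 ltrDl.
  apply: sum_uniq_le => // i; rewrite !inE mem_letters.
  by move=> /orP[]/eqP->.
have [P2|nP2] := pselect (forall e : R, 0 < e -> exists n, forall N,
    Z (letters 0 N) h n <= e).
  apply: hausdorff_measure_eq0 => // e e0.
  have B0 : 0 < (K * 2) `^ h by rewrite powR_gt0// mulr_gt0.
  have [|n nP] := P2 (e / (K * 2) `^ h); first by rewrite divr_gt0.
  have [V [JV Vs]] := level_cover h_ge0 nP; exists V; split=> //.
  by apply: le_trans Vs _; rewrite lee_fin mulrC divfK// gt_eqF.
have [c2 c20 c2P] : exists2 c2 : R, 0 < c2 & forall n, exists N,
    c2 <= Z (letters 0 N) h n.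
  apply: contrapT => nc2; apply: nP2 => e e0; apply: contrapT => ne.
  apply: nc2; exists e => // n; apply: contrapT => nN; apply: ne; exists n => N.
  by rewrite leNgt; apply/negP => /ltW ?; apply: nN; exists N.
apply: hausdorff_measure_eq0 => // e e0.
pose q N : R := N%:R `^ (- gamma).
(* One rotation [j0] for each of the [N] indices from [N] to [2 N - 1] gives enough mass. *)
have tail_mass N r : (L <= N)%N -> (N <= r)%N ->
    N%:R * (c * q N * q N) `^ h <= \sum_(i <- letters N r) rho [:: i] `^ h.
  move=> LN Nr; pose j0 := Ordinal T_gt0.
  apply: (@le_trans _ _ (\sum_(i <- [seq (n, j0) | n <- iota N N]) rho [:: i] `^
    h)).
    have -> x : N%:R * x = \sum_(n <- iota N N) x :> R.
      by rewrite big_const_seq count_predT size_iota iter_addr_0 mulr_natl.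
    rewrite big_map.
    rewrite [leLHS]big_seq [leRHS]big_seq; apply: ler_sum => n.
    rewrite mem_iota => /andP[_ nNN].
    apply: ge0_ler_powR; rewrite ?nnegrE ?mulr_ge0 ?powR_ge0 ?(ltW c_gt0)//.
    exact: rho_ge.
  apply: sum_uniq_le => [|i|i /mapP[n]].
  - by rewrite map_inj_uniq ?iota_uniq// => n n' [].
  - exact: powR_ge0.
  - rewrite mem_iota => /andP[Nn nN] ->; rewrite mem_letters/= Nn/=.
    by rewrite (leq_trans nN) ?leq_add2l.
pose G N := Kt h * Kt h * Kt h / (c2 * (N%:R * (c * q N * q N) `^ h)).
have sumZ N k : (L <= N)%N -> \sum_(j < k) Z (letters 0 N) h j <= G N.
  move=> LN.
  have N0 : (0 < N)%N by exact: leq_trans LN.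
  have q0 : 0 < q N by rewrite powR_gt0// ltr0n.
  (* The alphabet in [c2P] depends on the word length. Only finitely many lengths occur here, and by
     [Z_mono] one large alphabet serves them all. *)
  have [r Nr rP] : exists2 r, (N <= r)%N & forall j, (j < k)%N ->
      c2 <= Z (letters 0 (N + r)) h j.
    elim: k => [|k [r Nr rP]]; first by exists N.
    have [p pP] := c2P k; exists (maxn r p); first by rewrite leq_max Nr.
    move=> j; rewrite ltnS leq_eqVlt => /predU1P[->|/rP /le_trans]; last first.
      by apply; apply: Z_mono; rewrite leq_add2l leq_maxl.
    apply: le_trans pP _; apply: Z_mono.
    by rewrite (leq_trans (leq_maxr r p)) ?leq_addl.
  have S0 : 0 < c2 * (N%:R * (c * q N * q N) `^ h).
    by rewrite !mulr_gt0 ?powR_gt0 ?ltr0n ?mulr_gt0.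
  rewrite ler_pdivlMr// mulr_suml.
  have := @first_exit (letters 0 N) (letters (0 + N) r) h k h_ge0.
  rewrite -letters_cat => /le_trans fe.
  apply: le_trans (fe _ (ler_wpM2l _ (critical (N + r)%N k))); last first.
    by rewrite mulr_ge0 ?powR_ge0.
  apply: ler_sum => j _; rewrite -[leRHS]mulrA ler_wpM2l// mulrC ler_pM//.
  - by rewrite mulr_ge0 ?powR_ge0.
  - exact: ltW.
  - exact: tail_mass.
  - by apply: rP; rewrite ltn_subrL/=; case: (k) j => // -[].
(* [B] collects the factors of the tail cost that do not depend on [N]; what remains is a negative
   power of [N]. *)
pose B := (K * M) `^ h * (Kt h * Kt h * Kt h / (c2 * c `^ h)).
have B_ge0 : 0 <= B by rewrite !mulr_ge0 ?invr_ge0 ?mulr_ge0 ?powR_ge0 ?ltW.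
have p0 : 0 < 1 - gamma * h.
  by rewrite subr_gt0 (le_lt_trans _ gt1_lt1)// ler_wpM2l// ltW.
have [N LN BN] := @exists_nat_powR_ge R (1 - gamma * h) (B / (e / 2)) L p0.
have N0 : (0 < N)%N by exact: leq_ltn_trans LN.
have NR0 : 0 < N%:R :> R by rewrite ltr0n.
have q0 : 0 < q N by rewrite powR_gt0.
have tail_cost : (K * (M * q N)) `^ h * G N <= e / 2.
  have -> : (K * (M * q N)) `^ h * G N = B / N%:R `^ (1 - gamma * h).
    have -> : N%:R `^ (1 - gamma * h) = N%:R * q N `^ h :> R.
      rewrite /q -powRrM mulNr powRD ?powRr1//.
      by apply/implyP => _; rewrite gt_eqF.
    rewrite /G /B mulrA !powRM ?mulr_ge0 ?(ltW q0) ?(ltW c_gt0)//.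
    have qh0 : q N `^ h != 0 by rewrite gt_eqF// powR_gt0.
    have ch0 : c `^ h != 0 by rewrite gt_eqF// powR_gt0.
    have c20' : c2 != 0 by rewrite gt_eqF.
    have N0' : N%:R != 0 :> R by rewrite gt_eqF.
    by field; rewrite qh0 ch0 c20' N0'.
  rewrite ler_pdivrMr ?powR_gt0// mulrC -ler_pdivrMr// divr_gt0//.
(* [N] is already fixed. As [G N] bounds the sum over any number of levels, some level [k] over the
   first [N] letters is small enough to pay for the codings that have not left them. *)
have [k kP] : exists k, Z (letters 0 N) h k <= e / 2 / (K * 2) `^ h.
  apply: (@exists_small_term _ _ (G N)).
    by rewrite !divr_gt0 ?powR_gt0 ?mulr_gt0.
  by move=> k; apply: sumZ; exact: ltnW.
have [V [JV Vs]] := @exit_cover h N k h_ge0 N0.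
exists V; split=> //; apply: le_trans Vs _; rewrite lee_fin.
rewrite [e]splitr; apply: lerD.
  by rewrite mulrC -ler_pdivlMr ?powR_gt0// mulr_gt0.
apply: le_trans tail_cost; apply: ler_wpM2l; first exact: powR_ge0.
by apply: sumZ; exact: ltnW.
Qed.

End InfiniteSystem.

(** * The complex plane *)

Section Plane.
Local Open Scope complex_scope.
Import Normc.
Variable R : realType.
Local Notation E := 'rV[R]_2.
Local Notation C := R[i].
Implicit Types (v x y : E) (z : C).

Lemma to_planeK : cancel (@to_plane R) (@of_plane R).
Proof. by case=> u v; rewrite /of_plane /to_plane !mxE. Qed.

Lemma of_planeK : cancel (@of_plane R) (@to_plane R).
Proof.
move=> v; apply/rowP => k; rewrite mxE /of_plane.
by case: k => -[|[|//]] ?; congr (v _ _); apply: val_inj.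
Qed.

Lemma of_planeB x y : of_plane (x - y) = of_plane x - of_plane y.
Proof. by rewrite /of_plane !mxE. Qed.

Lemma of_planeD x y : of_plane (x + y) = of_plane x + of_plane y.
Proof. by rewrite /of_plane !mxE. Qed.

Lemma of_planeZ (k : R) x : of_plane (k *: x) = k%:C * of_plane x.
Proof. by rewrite /of_plane !mxE; apply/eqP; rewrite eq_complex /=; apply/andP;
  split; apply/eqP; ring. Qed.

Lemma of_plane0 : of_plane (0 : E) = 0.
Proof. by rewrite -(subrr (0 : E)) of_planeB subrr. Qed.

Lemma to_planeB z z' : to_plane (z - z') = to_plane z - to_plane z'.
Proof. by apply: (can_inj of_planeK); rewrite of_planeB !to_planeK. Qed.

Lemma enormE v : enorm v = normc (of_plane v).
Proof.
rewrite /enorm /edot /of_plane /= big_ord_recl big_ord1 -!expr2.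
by congr (Num.sqrt (_ ^+ 2 + v _ _ ^+ 2)); apply: val_inj.
Qed.

Lemma normc_ge0 z : 0 <= normc z.
Proof. by case: z => u v; exact: sqrtr_ge0. Qed.

Lemma normc_eq0 z : (normc z == 0) = (z == 0).
Proof. by apply/eqP/eqP => [/eq0_normc//|->]; exact: normc0. Qed.

Lemma normc_gt0 z : (0 < normc z) = (z != 0).
Proof. by rewrite lt_def normc_ge0 andbT normc_eq0. Qed.

Lemma complex_normE z : `|z| = (normc z)%:C.
Proof. by []. Qed.

Lemma normc_real (r : R) : normc r%:C = `|r|.
Proof. by rewrite /= expr0n/= addr0 sqrtr_sqr. Qed.

Lemma normc_conj z : normc z^*%C = normc z.
Proof. by case: z => u v /=; rewrite sqrrN. Qed.

Lemma normcX z n : normc (z ^+ n) = normc z ^+ n.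
Proof. by elim: n => [|n IH]; rewrite ?normc1// !exprS normcM IH. Qed.

Lemma normcB z z' : normc (z - z') = normc (z' - z).
Proof. by rewrite -normcN opprB. Qed.

Lemma lerB_normcD z z' : normc z - normc z' <= normc (z + z').
Proof. by rewrite lerBlDr -{1}(addrK z' z) -(normcN z') le_normcD. Qed.

Lemma lerB_normcB z z' : normc z - normc z' <= normc (z - z').
Proof. by rewrite -(normcN z') lerB_normcD. Qed.

Lemma ler_normcB z z' : normc (z - z') <= normc z + normc z'.
Proof. by rewrite -(normcN z') le_normcD. Qed.

Lemma enormB x y : enorm (x - y) = enorm (y - x).
Proof. by rewrite !enormE !of_planeB normcB. Qed.

Lemma enorm_eq0 x : (enorm x == 0) = (x == 0).
Proof.
rewrite enormE normc_eq0 -of_plane0.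
by apply/eqP/eqP => [|->//]; exact: (can_inj of_planeK).
Qed.

Lemma enormZ (k : R) x : enorm (k *: x) = `|k| * enorm x.
Proof. by rewrite !enormE of_planeZ normcM normc_real. Qed.

Lemma ler_enormD x y : enorm (x + y) <= enorm x + enorm y.
Proof. by rewrite !enormE of_planeD le_normcD. Qed.

(** Topology and derivative refer to the sup norm, while all estimates are Euclidean; this bound and
    [enorm_le_mx_norm] pass between the two. *)
Lemma mx_norm_le_enorm v : `|v| <= enorm v.
Proof.
rewrite [`|v|]mx_normrE; apply: bigmax_le; first exact: enorm_ge0.
move=> [i j] _ /=; rewrite /enorm /edot -sqrtr_sqr ler_sqrt; last first.
  by apply: sumr_ge0 => k _; rewrite -expr2 sqr_ge0.
rewrite (bigD1 j)//= (ord1 i) -expr2 lerDl sumr_ge0// => k _.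
by rewrite -expr2 sqr_ge0.
Qed.

Lemma enorm_le_mx_norm v : enorm v <= 2 * `|v|.
Proof.
have coord k : `|v 0 k| <= `|v|.
  rewrite [`|v|]mx_normrE.
  exact: (le_bigmax _ (fun ij => `|v ij.1 ij.2|) (0, k)).
have vE : v = \row_k (if k == 0 then v 0 0 else 0) + \row_k (if k == 0 then 0
  else v 0 1).
  apply/rowP => k; rewrite !mxE.
  by case: k => -[|[|//]] ?; rewrite ?addr0 ?add0r; congr (v _ _); apply: val_inj.
rewrite {1}vE; apply: le_trans (ler_enormD _ _) _.
rewrite mulr_natl mulr2n lerD//.
- rewrite /enorm /edot big_ord_recl big_ord1 !mxE/= mulr0 addr0 -expr2 sqrtr_sqr.
  exact: coord.
- rewrite /enorm /edot big_ord_recl big_ord1 !mxE/= mulr0 add0r -expr2 sqrtr_sqr.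
  exact: coord.
Qed.

Lemma near_enorm_lt x (e : R) : 0 < e -> \forall y \near x, enorm (x - y) < e.
Proof.
move=> e0; apply/nbhs_ballP; exists (e / 2) => /=; first by rewrite divr_gt0.
move=> y; rewrite -ball_normE /= => xy.
apply: le_lt_trans (enorm_le_mx_norm _) _.
by rewrite mulrC -ltr_pdivlMr.
Qed.

Lemma enorm_lipschitz_continuous (V : set E) (f : E -> E) (k : R) : open V ->
  (forall x y, V x -> V y -> enorm (f x - f y) <= k * enorm (x - y)) ->
  forall x, V x -> {for x, continuous f}.
Proof.
move=> oV fk x Vx; rewrite /prop_for /continuous_at;
  apply/(@cvgrPdist_lt _ _ _ _ (nbhs_filter x)) => e e0.
have k0 : 0 < `|k| + 1 by rewrite ltr_wpDl.
have nV : nbhs x V by exact: open_nbhs_nbhs.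
near=> y; apply: le_lt_trans (mx_norm_le_enorm _) _.
have Vy : V y by near: y; exact: nV.
apply: le_lt_trans (fk _ _ Vx Vy) _.
apply: (@le_lt_trans _ _ ((`|k| + 1) * enorm (x - y))).
  by rewrite ler_wpM2r ?enorm_ge0// (le_trans (ler_norm _))// lerDl.
rewrite mulrC -ltr_pdivlMr//; near: y; apply: near_enorm_lt.
by rewrite divr_gt0.
Unshelve. all: by end_near. Qed.

Lemma enorm_lipschitz_continuousR (f : E -> R) (k : R) :
  (forall x y, `|f x - f y| <= k * enorm (x - y)) -> continuous f.
Proof.
move=> fk x; apply/(@cvgrPdist_lt _ _ _ _ (nbhs_filter x)) => e e0.
have k0 : 0 < `|k| + 1 by rewrite ltr_wpDl.
near=> y; apply: le_lt_trans (fk _ _) _.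
apply: (@le_lt_trans _ _ ((`|k| + 1) * enorm (x - y))).
  by rewrite ler_wpM2r ?enorm_ge0// (le_trans (ler_norm _))// lerDl.
rewrite mulrC -ltr_pdivlMr//; near: y; apply: near_enorm_lt.
by rewrite divr_gt0.
Unshelve. all: by end_near. Qed.

Lemma normc_affine_continuous (p q : C) :
  continuous (fun v : E => normc (p * of_plane v + q)).
Proof.
apply: (@enorm_lipschitz_continuousR _ (normc p)) => x y.
rewrite enormE of_planeB -normcM ler_norml; apply/andP.
have -> : p * (of_plane x - of_plane y) =
  (p * of_plane x + q) - (p * of_plane y + q) by ring.
split; last exact: lerB_normcB.
by rewrite -[leRHS]opprB lerN2 normcB lerB_normcB.
Qed.

(** Discs and their Moebius images both take this form once denominators are cleared. *)
Lemma open_normc_lt (p q p' q' : C) :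
  open [set v : E | normc (p * of_plane v + q) < normc (p' * of_plane v + q')].
Proof.
have -> : [set v : E | normc (p * of_plane v + q) < normc (p' * of_plane v + q')] =
  (fun v => normc (p' * of_plane v + q') - normc (p * of_plane v + q)) @^-1`
     [set r : R | 0 < r] by apply/seteqP; split=> v /=; rewrite subr_gt0.
apply: open_comp; last exact: open_gt.
by move=> v _; exact: (cvgB (@normc_affine_continuous p' q' v)
  (@normc_affine_continuous p q v)).
Qed.

Definition cmul (D : C) v := to_plane (D * of_plane v).

Lemma enorm_cmul (D : C) v : enorm (cmul D v) = normc D * enorm v.
Proof. by rewrite !enormE to_planeK normcM. Qed.

Lemma opnorm_cmul (D : C) : opnorm (cmul D) = normc D.
Proof.
apply/eqP; rewrite eq_le; apply/andP; split.
  apply: ge_sup; first by exists (enorm (cmul D 0)), 0 => //=;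
    rewrite enormE of_plane0 normc0.
  move=> _ [v /= v1 <-]; rewrite enorm_cmul ler_piMr//; exact: normc_ge0.
apply: ub_le_sup.
  exists (normc D) => _ [v /= v1 <-].
  by rewrite enorm_cmul ler_piMr ?normc_ge0.
exists (to_plane 1) => /=; first by rewrite enormE to_planeK normc1.
by rewrite enorm_cmul enormE to_planeK normc1 mulr1.
Qed.

Lemma cmul_is_linear (D : C) : linear (cmul D).
Proof.
move=> k u v; apply: (can_inj of_planeK).
rewrite of_planeD of_planeZ !to_planeK of_planeD of_planeZ; ring.
Qed.

HB.instance Definition _ (D : C) :=
  GRing.isLinear.Build R E E _ (cmul D) (cmul_is_linear D).

(** For Moebius maps the remainder is explicit and quadratic, so a plain inequality on [V] replaces
    the little-o expansion. *)
Lemma is_diff_cmul (V : set E) (f : E -> E) x (D : C) (k : R) : open V -> V x ->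
  (forall y, V y -> enorm (f y - f x - cmul D (y - x)) <= k * enorm (y - x) ^+ 2) ->
  is_diff x f (cmul D).
Proof.
move=> oV Vx fD.
have cont : continuous (cmul D).
  move=> v; apply: (@enorm_lipschitz_continuous setT _ (normc D)) => //.
    exact: openT.
  by move=> u w _ _; rewrite -enorm_cmul linearB.
have expand : f \o shift x =
    cst (f x) + (cmul D : (E : normedModType R) -> (E : normedModType R)) +o_ (0
      : E) id.
  apply/eqaddoP => e e0; have k0 : 0 < `|k| + 1 by rewrite ltr_wpDl.
  near=> h.
  have Vhx : V (h + x).
    near: h; have /nbhs_ballP[d /= d0 dV] : nbhs x V by exact: open_nbhs_nbhs.
    apply/nbhs_ballP; exists d => // h; rewrite -!ball_normE /= => hd.
    by apply: dV; rewrite -ball_normE /= opprD addrCA subrr addr0 -[- h]add0r.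
  rewrite [X in `|X|](_ : _ = f (h + x) - f x - cmul D (h + x - x)); last first.
    by rewrite addrK /cst /= -addrA -opprD.
  apply: le_trans (mx_norm_le_enorm _) _.
  apply: le_trans (fD _ Vhx) _; rewrite addrK expr2 mulrA.
  have h2 := enorm_le_mx_norm h.
  (* The half absorbs the factor 2 of [enorm_le_mx_norm]. *)
  have hs : (`|k| + 1) * enorm h <= e / 2.
    rewrite mulrC -ler_pdivlMr//; apply/ltW; rewrite -[h]subr0 enormB.
    near: h; apply: near_enorm_lt; by rewrite !divr_gt0.
  apply: (@le_trans _ _ (e / 2 * enorm h)).
    rewrite ler_wpM2r ?enorm_ge0//; apply: le_trans hs.
    by rewrite ler_wpM2r ?enorm_ge0// (le_trans (ler_norm _))// lerDl.
  rewrite -mulrA ler_wpM2l ?(ltW e0)//.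
  by rewrite ler_pdivrMl.
have dE := diff_unique cont expand.
by constructor => //; apply/diff_locallyP; rewrite dE.
Unshelve. all: by end_near. Qed.

End Plane.

(** * Moebius maps in two-point form *)

Section Mobius.
Local Open Scope complex_scope.
Import Normc.
Variable R : realType.
Local Notation E := 'rV[R]_2.
Local Notation C := R[i].
Implicit Types (V : set E) (v x y : E) (e c d : C) (lo : R).

(* The two-point form of [phi] having derivative [e / (c x + d) ^ 2], with the
   pole kept away from [V]; it avoids any reference to the numerator. *)
Definition mobius_on V (phi : E -> E) e c d lo : Prop :=
  [/\ 0 < lo, e != 0,
      forall x, V x -> lo <= normc (c * of_plane x + d) <= 5 * lo &
      forall x y, V x -> V y -> of_plane (phi x) - of_plane (phi y) =
        e * (of_plane x - of_plane y) /
        ((c * of_plane x + d) * (c * of_plane y + d))].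

Section Basic.
Variables (V : set E) (phi : E -> E) (e c d : C) (lo : R).
Hypothesis phiM : mobius_on V phi e c d lo.
Local Notation den x := (c * of_plane x + d).

Let lo_gt0 : 0 < lo. Proof. by case: phiM. Qed.
Let e_neq0 : e != 0. Proof. by case: phiM. Qed.

Let den_ge x : V x -> lo <= normc (den x).
Proof. by case: phiM => _ _ H _ /H /andP[]. Qed.

Let den_le x : V x -> normc (den x) <= 5 * lo.
Proof. by case: phiM => _ _ H _ /H /andP[]. Qed.

Let nden_gt0 x : V x -> 0 < normc (den x).
Proof. by move=> /den_ge; exact: lt_le_trans. Qed.

Let den_neq0 x : V x -> den x != 0.
Proof. by move=> /nden_gt0; rewrite normc_gt0. Qed.

Let formula x y : V x -> V y -> of_plane (phi x) - of_plane (phi y) =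
  e * (of_plane x - of_plane y) / (den x * den y).
Proof. by case: phiM => _ _ _; apply. Qed.

Lemma mobius_dist x y : V x -> V y -> enorm (phi x - phi y) =
  normc e * enorm (x - y) / (normc (den x) * normc (den y)).
Proof.
by move=> Vx Vy; rewrite !enormE !of_planeB formula// !normcM normcV normcM.
Qed.

Lemma mobius_lipschitz x y : V x -> V y ->
  enorm (phi x - phi y) <= normc e / lo ^+ 2 * enorm (x - y).
Proof.
move=> Vx Vy; rewrite mobius_dist// [leRHS]mulrAC ler_wpM2l//.
  by rewrite mulr_ge0 ?normc_ge0 ?enorm_ge0.
rewrite lef_pV2 ?posrE ?exprn_gt0 ?mulr_gt0 ?nden_gt0// expr2.
by rewrite ler_pM ?den_ge// ltW.
Qed.

Lemma mobius_inj x y : V x -> V y -> phi x = phi y -> x = y.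
Proof.
move=> Vx Vy xy; apply/eqP; rewrite -subr_eq0 -enorm_eq0.
have := mobius_dist Vx Vy; rewrite xy subrr => /eqP.
rewrite (_ : enorm 0 = 0); last by rewrite enormE of_plane0 normc0.
rewrite eq_sym !mulf_eq0 invr_eq0 mulf_eq0 normc_eq0 (negbTE e_neq0)/=.
by rewrite !normc_eq0 !(negbTE (den_neq0 _))// !orbF.
Qed.

(** Two denominators on each side, each varying by a factor of at most 5, give 25. *)
Lemma mobius_distortion x y x' y' : V x -> V y -> V x' -> V y' ->
  enorm (phi x - phi y) * enorm (x' - y') <=
    25 * enorm (phi x' - phi y') * enorm (x - y).
Proof.
move=> Vx Vy Vx' Vy'; rewrite !mobius_dist//.
set n1 := normc (den x); set n2 := normc (den y).
set n3 := normc (den x'); set n4 := normc (den y').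
have -> : normc e * enorm (x - y) / (n1 * n2) * enorm (x' - y') =
  (normc e * enorm (x - y) * enorm (x' - y')) * (n1 * n2)^-1 by ring.
have -> : 25 * (normc e * enorm (x' - y') / (n3 * n4)) * enorm (x - y) =
  (normc e * enorm (x - y) * enorm (x' - y')) * (25 / (n3 * n4)) by ring.
rewrite ler_wpM2l ?mulr_ge0 ?normc_ge0 ?enorm_ge0//.
have [p1 p2 p3 p4] : [/\ 0 < n1, 0 < n2, 0 < n3 & 0 < n4] by split; exact: nden_gt0.
rewrite -[leLHS]mul1r ler_pdivrMr ?mulr_gt0// mulrAC ler_pdivlMr ?mulr_gt0// mul1r.
have -> : 25 * (n1 * n2) = (5 * n1) * (5 * n2) by ring.
apply: ler_pM; rewrite ?(ltW p3) ?(ltW p4)//.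
  by apply: le_trans (den_le Vx') _; rewrite ler_pM2l// den_ge.
by apply: le_trans (den_le Vy') _; rewrite ler_pM2l// den_ge.
Qed.

Lemma mobius_derivative_distortion x y : V x -> V y ->
  normc (e / den y ^+ 2) <= 25 * normc (e / den x ^+ 2).
Proof.
move=> Vx Vy; rewrite !normcM !normcV !normcX mulrCA ler_wpM2l ?normc_ge0//.
have [p1 p2] : 0 < normc (den x) /\ 0 < normc (den y) by split; exact: nden_gt0.
rewrite -[leLHS]mul1r ler_pdivrMr ?exprn_gt0// mulrAC ler_pdivlMr ?exprn_gt0//
  mul1r.
have -> : 25 * normc (den y) ^+ 2 = (5 * normc (den y)) ^+ 2 by ring.
rewrite ler_sqr ?nnegrE ?mulr_ge0 ?normc_ge0//.
by apply: le_trans (den_le Vx) _; rewrite ler_pM2l// den_ge.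
Qed.

Hypothesis V_open : open V.

Lemma mobius_is_diff x : V x -> is_diff x phi (cmul (e / den x ^+ 2)).
Proof.
move=> Vx.
apply: (@is_diff_cmul _ V phi x _ (normc e * normc c / lo ^+ 3)) => // y Vy.
rewrite !enormE !of_planeB formula// /cmul to_planeK of_planeB.
set px := of_plane x; set py := of_plane y.
have dx := den_neq0 Vx; have dy := den_neq0 Vy; rewrite -/px -/py in dx dy.
have -> : e * (py - px) / ((c * py + d) * (c * px + d)) - e / (c * px + d) ^+ 2 *
  (py - px) =
   - (e * c * (py - px) ^+ 2 / ((c * py + d) * (c * px + d) ^+ 2)).
  by field; rewrite dx dy.
rewrite normcN !normcM normcV normcM !normcX [leRHS]mulrAC ler_wpM2l//.
  by rewrite !mulr_ge0 ?exprn_ge0 ?normc_ge0.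
rewrite lef_pV2 ?posrE ?mulr_gt0 ?exprn_gt0 ?normc_gt0// exprS.
rewrite ler_pM ?exprn_ge0 ?(ltW lo_gt0)// ?den_ge//
  lerXn2r ?nnegrE ?normc_ge0 ?(ltW lo_gt0)//.
exact: den_ge.
Qed.

Lemma mobius_opnorm x : V x -> opnorm ('d phi x) = normc (e / den x ^+ 2).
Proof.
by move=> Vx; have dphi := mobius_is_diff Vx;
  rewrite (@diff_val _ _ _ _ _ _ _ dphi) opnorm_cmul.
Qed.

Lemma mobius_opnorm_distortion x y : V x -> V y ->
  opnorm ('d phi y) <= 25 * opnorm ('d phi x).
Proof.
move=> Vx Vy; apply: (@le_trans _ _ (normc (e / den y ^+ 2))).
  by rewrite (mobius_opnorm Vy).
apply: le_trans (mobius_derivative_distortion Vx Vy) _.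
by rewrite (mobius_opnorm Vx).
Qed.

Lemma mobius_C1_hoelder : C1_hoelder 1 V phi.
Proof.
split=> [x Vx|]; first by have dphi := mobius_is_diff Vx.
(* The difference of the two inverse squares has in its numerator the factor [px - py] and a sum of
   two denominators, at most [10 * lo]; below stand four denominators, each at least [lo]. *)
exists (normc e * normc c * (10 * lo) / lo ^+ 4) => x y Vx Vy.
have dx := mobius_is_diff Vx; have dy := mobius_is_diff Vy.
rewrite powRr1 ?enorm_ge0//.
rewrite (_ : (fun v => _) = cmul (e / den x ^+ 2 - e / den y ^+ 2)); last first.
  apply/funext => v.
  have ex := congr1 (fun g => g v) (@diff_val _ _ _ _ _ _ _ dx).
  have ey := congr1 (fun g => g v) (@diff_val _ _ _ _ _ _ _ dy).
  apply: etrans (congr2 (fun p q => p - q) ex ey) _.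
  by rewrite /cmul -to_planeB mulrBl.
rewrite opnorm_cmul enormE of_planeB.
set px := of_plane x; set py := of_plane y.
have nx := den_neq0 Vx; have ny := den_neq0 Vy; rewrite -/px -/py in nx ny.
have -> : e / (c * px + d) ^+ 2 - e / (c * py + d) ^+ 2 =
   - (e * c * ((c * px + d) + (c * py + d)) * (px - py) /
      ((c * px + d) ^+ 2 * (c * py + d) ^+ 2)).
  by field; rewrite nx ny.
rewrite normcN normcM normcV [normc (_ ^+ 2 * _)]normcM !normcX [normc (_ * (px -
  py))]normcM.
rewrite [normc (e * c * _)]normcM [normc (e * c)]normcM.
rewrite [leRHS]mulrAC; apply: ler_pM.
- by rewrite !mulr_ge0 ?normc_ge0.
- by rewrite invr_ge0 mulr_ge0 ?exprn_ge0 ?normc_ge0.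
- rewrite ler_wpM2r ?normc_ge0// ler_wpM2l ?mulr_ge0 ?normc_ge0//.
  apply: le_trans (le_normcD _ _) _.
  have -> : 10 * lo = 5 * lo + 5 * lo by ring.
  by rewrite lerD ?den_le.
- rewrite lef_pV2 ?posrE ?mulr_gt0 ?exprn_gt0 ?normc_gt0//.
  rewrite (_ : lo ^+ 4 = lo ^+ 2 * lo ^+ 2); last by rewrite -exprD.
  by apply: ler_pM; rewrite ?exprn_ge0 ?(ltW lo_gt0)//
    lerXn2r ?nnegrE ?normc_ge0 ?(ltW lo_gt0)// den_ge.
Qed.

Lemma mobius_conformal : conformal_on V phi.
Proof.
move=> x Vx; have dphi := mobius_is_diff Vx; split; first exact: ex_diff.
exists (normc (e / den x ^+ 2)) => [|v];
  last by rewrite (@diff_val _ _ _ _ _ _ _ dphi) enorm_cmul.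
by rewrite normc_gt0 mulf_neq0 ?invr_eq0 ?expf_neq0 ?den_neq0.
Qed.

End Basic.

(** This is the neighbourhood [V] in the definition of a CIFS: it contains the closed unit disc, and
    all letters map it into itself. *)
Definition disc2 : set E := [set v | enorm v < 2].

Lemma disc2_open : open disc2.
Proof.
have -> : disc2 = [set v | normc (1 * of_plane v + 0) < normc (0 * of_plane v +
  2%:R%:C)].
  by apply/seteqP; split=> v;
    rewrite /disc2 /mkset mul1r mul0r addr0 add0r normc_real ger0_norm// enormE.
exact: open_normc_lt.
Qed.

Section Inverse.
Variables (phi : E -> E) (e c d : C) (lo : R).
Hypothesis phiM : mobius_on disc2 phi e c d lo.
Local Notation den x := (c * of_plane x + d).
(** The two-point formula at [x] and 0 reads u = e x / ((c x + d) d), where u = phi x - phi 0.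
    Solving for x gives [psi], with denominator e - d c u. *)
Let w0 := of_plane (phi 0).
Let u v := of_plane v - w0.
Let den' v := - (d * c) * of_plane v + (e + d * c * w0).
Let psi v := to_plane (d ^+ 2 * u v / den' v).

Let disc20 : disc2 (0 : E).
Proof. by rewrite /disc2/= enormE of_plane0 normc0. Qed.

Let den'E v : den' v = e - d * c * u v.
Proof. by rewrite /den' /u; ring. Qed.

Let e0 : e != 0. Proof. by case: phiM. Qed.

Let den0 x : disc2 x -> den x != 0.
Proof.
case: phiM => lo0 _ H _ /H /andP[+ _]; rewrite -normc_gt0; exact: lt_le_trans.
Qed.

Let d0 : d != 0.
Proof. by have := den0 disc20; rewrite of_plane0 mulr0 add0r. Qed.

Let uE x : disc2 x -> u (phi x) = e * of_plane x / (den x * d).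
Proof.
move=> Vx; case: phiM => _ _ _ /(_ x 0 Vx disc20).
by rewrite of_plane0 subr0 mulr0 add0r.
Qed.

Let den'_phi x : disc2 x -> den' (phi x) = e * d / den x.
Proof.
by move=> Vx; have nx := den0 Vx; rewrite den'E uE//; field; rewrite nx d0.
Qed.

Let psiK x : disc2 x -> psi (phi x) = x.
Proof.
move=> Vx; have nx := den0 Vx; apply: (can_inj (@of_planeK R)).
rewrite /psi to_planeK den'_phi// uE//; field.
by rewrite nx d0 e0.
Qed.

(** The image is the set where [psi] has modulus below 2. With the denominator cleared this compares
    the moduli of two affine functions, and the strict inequality also forces [den' v] to be
    nonzero. *)
Lemma mobius_image_open : open (phi @` disc2).
Proof.
have -> : phi @` disc2 = [set v | normc (d ^+ 2 * of_plane v + (- (d ^+ 2 * w0))) <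
    normc ((2%:R%:C * - (d * c)) * of_plane v + 2%:R%:C * (e + d * c * w0))].
  have rE v : (2%:R%:C * - (d * c)) * of_plane v + 2%:R%:C * (e + d * c * w0) =
    2%:R%:C * den' v.
    by rewrite /den'; ring.
  have lE v : d ^+ 2 * of_plane v + (- (d ^+ 2 * w0)) = d ^+ 2 * u v.
    by rewrite /u; ring.
  apply/seteqP; split=> [_ [x Vx <-]|v] /=; rewrite rE lE.
    have nx := den0 Vx; rewrite den'_phi// uE//.
    have -> : d ^+ 2 * (e * of_plane x / (den x * d)) = of_plane x * (e * d / den
      x).
      by field; rewrite nx d0.
    rewrite normcM [ltRHS]normcM normc_real ger0_norm// ltr_pM2r -?enormE//.
    by rewrite normc_gt0 !mulf_neq0 ?invr_eq0.
  rewrite [ltRHS]normcM normc_real ger0_norm// => lt.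
  have D0 : den' v != 0.
    by rewrite -normc_gt0 -(pmulr_rgt0 _ (ltr0Sn R 1)) (le_lt_trans _ lt)//
      normc_ge0.
  have pV : disc2 (psi v).
    rewrite /disc2/= enormE /psi to_planeK normcM normcV.
    by rewrite ltr_pdivrMr ?normc_gt0.
  exists (psi v) => //; apply: (can_inj (@of_planeK R)).
  apply/eqP; rewrite -(inj_eq (addIr (- w0))) -/(u _) uE//.
  have nx := den0 pV.
  have -> : den (psi v) = d * e / den' v.
    have eE : e = den' v + d * c * u v by rewrite den'E; ring.
    rewrite /psi to_planeK [X in _ = d * X / _]eE; field; exact: D0.
  rewrite /psi to_planeK; apply/eqP; rewrite -/(u v); field.
  by rewrite D0 d0 e0.
exact: open_normc_lt.
Qed.

(** At [phi x] the denominator of the inverse is [e * d / den x], so its two-sided bound again has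
    ratio 5. The inverse is thus itself a [mobius_on] map, and [mobius_C1_hoelder] applies to it. *)
Lemma mobius_diffeo : C1_hoelder_diffeo 1 disc2 phi.
Proof.
split.
- exact: mobius_C1_hoelder phiM disc2_open.
- exact: mobius_image_open.
- exists psi; split; last exact: psiK.
  have [lo0 _ B F] := phiM.
  apply: (@mobius_C1_hoelder _ psi (e * d ^+ 2) (- (d * c)) (e + d * c * w0)
    (normc (e * d) / (5 * lo))); last exact: mobius_image_open.
  split.
  + by rewrite divr_gt0 ?mulr_gt0// normc_gt0 mulf_neq0.
  + by rewrite mulf_neq0 ?expf_neq0.
  + move=> _ [x Vx <-]; rewrite -/(den' _) den'_phi// [normc (_ / _)]normcM normcV.
    have /andP[B1 B2] := B x Vx.
    have n0 : 0 < normc (den x) by rewrite normc_gt0 den0.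
    rewrite ler_wpM2l ?normc_ge0 ?lef_pV2 ?posrE ?mulr_gt0//=.
    have -> : 5 * (normc (e * d) / (5 * lo)) = normc (e * d) / lo.
      by field; rewrite gt_eqF.
    by rewrite ler_wpM2l ?normc_ge0 ?lef_pV2 ?posrE.
  + move=> _ _ [x Vx <-] [y Vy <-]; rewrite -!/(den' _) !den'_phi// !psiK// F//.
    by have nx := den0 Vx; have ny := den0 Vy; field; rewrite nx ny e0 d0.
Qed.

End Inverse.
End Mobius.

(** * Systems on the closed unit disc *)

Section Disc.
Local Open Scope complex_scope.
Import Normc.
Variable R : realType.
Local Notation E := 'rV[R]_2.
Local Notation C := R[i].
Implicit Types (v x y : E).

Lemma star_shaped_connected (A : set E) :
  (forall x (k : R), A x -> 0 <= k <= 1 -> A (k *: x)) -> connected A.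
Proof.
move=> starA; have [->|/eqP/set0P[x0 Ax0]] := pselect (A = set0).
  exact: connected0.
have -> : A = \bigcup_(x in A) ((fun k : R => k *: x) @` `[0, 1]).
  apply/seteqP; split=> [x Ax|_ [x Ax [k /= k01 <-]]].
    by exists x => //; exists 1; rewrite ?scale1r//= in_itv/= ler01 lexx.
  by apply: starA => //; rewrite in_itv in k01.
apply: bigcup_connected => [|x _].
  exists 0 => x Ax; exists 0; rewrite ?scale0r//=.
  by rewrite in_itv/= ler01 lexx.
apply: connected_continuous_connected; first exact: segment_connected.
apply: continuous_subspaceT => k; exact: scalel_continuous.
Qed.

Lemma enorm_continuous : continuous (@enorm R 2).
Proof.
apply: (@enorm_lipschitz_continuousR _ _ 1) => x y.
rewrite mul1r !enormE of_planeB ler_norml lerB_normcB andbT.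
by rewrite -[leRHS]opprB lerN2 normcB lerB_normcB.
Qed.

Lemma unit_discE : @unit_disc R = [set v | enorm v < 1].
Proof.
by apply/seteqP; split=> v; rewrite /unit_disc/= complex_normE ltcR enormE.
Qed.

Lemma closed_discE : closed_disc = [set v : E | enorm v <= 1].
Proof.
rewrite /closed_disc unit_discE; apply/seteqP; split=> [v cv|v /= v1].
  have cl : closed [set v : E | enorm v <= 1].
    have -> : [set v : E | enorm v <= 1] = @enorm R 2 @^-1` [set r | r <= 1] by [].
    by apply: closed_comp; [move=> ? _; exact: enorm_continuous|exact: closed_le].
  by apply: cl; apply: closure_subset cv => w /=; exact: ltW.
move=> B /nbhs_ballP[r /= r0 rB].
pose k := Num.min (r / 2) 2^-1.
have [k0 k1 kr] : [/\ 0 < k, k <= 2^-1 & k < r].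
  split; first by rewrite lt_min divr_gt0//= invr_gt0.
    by rewrite ge_min lexx orbT.
  by rewrite gt_min ltr_pdivrMr// ltr_pMr// ltr1n.
exists ((1 - k) *: v); split.
  rewrite /= enormZ ger0_norm; last by lra.
  by apply: (@le_lt_trans _ _ (1 - k)); [rewrite ler_piMr//; lra|lra].
apply: rB; rewrite -ball_normE /= scalerBl scale1r opprB addrCA subrr addr0.
apply: le_lt_trans (mx_norm_le_enorm _) _; rewrite enormZ gtr0_norm//.
by apply: le_lt_trans kr; rewrite ler_piMr// ltW.
Qed.

Lemma open_enorm_lt (r : R) : open [set v : E | enorm v < r].
Proof.
have -> : [set v : E | enorm v < r] = @enorm R 2 @^-1` [set t | t < r] by [].
by apply: open_comp; [move=> ? _; exact: enorm_continuous|exact: open_lt].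
Qed.

Lemma closed_disc_interior : (closed_disc : set E)° = [set v | enorm v < 1].
Proof.
rewrite closed_discE; apply/seteqP; split=> [v|v v1]; last first.
  move: v v1; rewrite -/(_ `<=` _) -(open_subsetE _ (@open_enorm_lt 1)).
  by move=> w /=; exact: ltW.
move=> /nbhs_ballP[r /= r0 rB]; have v1 : enorm v <= 1.
  by apply: rB; exact: ballxx.
rewrite lt_neqAle v1 andbT; apply/eqP => ev.
have : enorm ((1 + r / 2) *: v) <= 1.
  apply: rB; rewrite -ball_normE /= scalerDl scale1r opprD addrA subrr add0r normrN.
  apply: le_lt_trans (mx_norm_le_enorm _) _; rewrite enormZ ev mulr1.
  by rewrite gtr0_norm ?divr_gt0// ltr_pdivrMr// ltr_pMr// ltr1n.
by rewrite enormZ ev mulr1 ger0_norm; lra.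
Qed.

Lemma closed_disc_compact : compact (closed_disc : set E).
Proof.
apply: bounded_closed_compact; last exact: closed_closure.
exists 1; split=> // r r1 v; rewrite closed_discE /= => v1.
by apply: le_trans (mx_norm_le_enorm _) _; apply: le_trans v1 (ltW _).
Qed.

Lemma closed_disc_connected : connected (closed_disc : set E).
Proof.
rewrite closed_discE; apply: star_shaped_connected => x k /= x1 /andP[k0 k1].
by rewrite enormZ ger0_norm// mulr_ile1// enorm_ge0.
Qed.

Lemma disc2_connected : connected (@disc2 R).
Proof.
apply: star_shaped_connected => x k; rewrite /disc2 /= => x2 /andP[k0 k1].
by rewrite enormZ ger0_norm// (le_lt_trans _ x2)// ler_piMl// enorm_ge0.
Qed.

Lemma closed_disc_sub_disc2 : closed_disc `<=` @disc2 R.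
Proof. by rewrite closed_discE => v /= v1; rewrite /disc2/=; lra. Qed.

Lemma edotC x y : edot x y = edot y x.
Proof. by apply: eq_bigr => i _; rewrite mulrC. Qed.

Lemma enorm_sqr x : enorm x ^+ 2 = edot x x.
Proof. by rewrite sqr_sqrtr// sumr_ge0// => i _; rewrite -expr2 sqr_ge0. Qed.

Lemma edotBl x y z : edot (x - y) z = edot x z - edot y z.
Proof. by rewrite /edot -sumrB; apply: eq_bigr => i _; rewrite !mxE mulrBl. Qed.

Lemma edotN x y : edot x (- y) = - edot x y.
Proof. by rewrite /edot -sumrN; apply: eq_bigr => i _; rewrite !mxE mulrN. Qed.

(* The cone at [x] points to the centre, with [cos alpha = 1 / 2] and [l = 1]. *)
Lemma closed_disc_cone : cone_condition (closed_disc : set E).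
Proof.
have p0 := pi_gt0 R.
have h11 : -1 <= (2^-1 : R) <= 1 by apply/andP; split; lra.
exists (acos 2^-1), 1; split=> [|||x []].
- by apply: acos_gt0; apply/andP; split; lra.
- have : cos (pi / 2) < cos (acos (2^-1 : R)) by rewrite cos_pihalf acosK//
  invr_gt0.
  rewrite ltr_cos// in_itv/=; first by rewrite acos_ge0//= acos_lepi.
  by apply/andP; split; lra.
- exact: ltr01.
rewrite -(closure_id _).1; last by rewrite /closed_disc; exact: closed_closure.
rewrite closed_disc_interior closed_discE /= => x1 /negP; rewrite -leNgt => x1'.
have ex : enorm x = 1 by apply/eqP; rewrite eq_le x1.
exists (- x) => [|y /=]; first by rewrite oppr_eq0 -enorm_eq0 ex oner_eq0.
have eNx : enorm (- x) = 1 by rewrite -scaleN1r enormZ normrN1 ex mulr1.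
rewrite acosK// edotN eNx mulr1 => -[/andP[r0 r1] cone].
have : enorm y ^+ 2 < 1.
  (* The cone condition says [2 * edot (y - x) x < - enorm (y - x)]. This outweighs the square, the
     length being below 1. *)
  have -> : enorm y ^+ 2 = enorm (y - x) ^+ 2 + 2 * edot (y - x) x + enorm x ^+ 2.
    rewrite !enorm_sqr !edotBl ![edot _ (y - x)]edotC !edotBl (edotC x y); ring.
  rewrite ex expr1n.
  have : enorm (y - x) ^+ 2 < enorm (y - x) by rewrite expr2 gtr_pMr.
  by lra.
by rewrite expr_lt1// enorm_ge0.
Qed.

End Disc.

(** * Systems whose inverted images lie in unit discs about the parameters *)

Section PlaneSystem.
Local Open Scope complex_scope.
Import Normc.
Variables (R : realType) (T : nat).
Local Notation E := 'rV[R]_2.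
Local Notation C := R[i].
Local Notation I := (nat * 'I_T)%type.
Variables (alpha : I -> C) (s : I -> E -> E).
Hypothesis T_gt0 : (0 < T)%N.
Hypothesis alpha_ge : forall i, 101 <= normc (alpha i).
Hypothesis alpha_sep : forall i j, i <> j -> 3 <= normc (alpha i - alpha j).
Hypothesis word_mobius : forall w, exists e c d lo,
  mobius_on (@disc2 R) (word_map s w) e c d lo.
Hypothesis s_disc2 : forall i x, disc2 x -> disc2 (s i x).
Hypothesis s_image : forall i x, closed_disc x ->
  of_plane (s i x) != 0 /\ normc ((of_plane (s i x))^-1 - alpha i) <= 1.

Let image_bounds i x : closed_disc x ->
  (normc (alpha i) + 1)^-1 <= enorm (s i x) <= (normc (alpha i) - 1)^-1.
Proof.
move=> /(s_image i); rewrite enormE; set z := of_plane _ => -[z0 zi].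
have nz : 0 < normc z by rewrite normc_gt0.
have nv : 0 < (normc z)^-1 by rewrite invr_gt0.
have a101 := alpha_ge i.
have b1 := lerB_normcB z^-1 (alpha i); rewrite normcV in b1.
have b2 := lerB_normcB (alpha i) z^-1; rewrite normcB normcV in b2.
rewrite -[normc z]invrK !lef_pV2 ?posrE//; last by lra.
  by apply/andP; split; lra.
by lra.
Qed.

(** Inverted, the images lie in unit discs whose centres are at distance at least 3, hence at
    distance at least 1 from each other. The identity for [z - z'] carries this back, with the
    moduli of [z] and [z'] bounded below. *)
Lemma plane_system_gap i j : i <> j -> exists2 d : R, 0 < d &
  forall x y, closed_disc x -> closed_disc y -> d <= enorm (s i x - s j y).
Proof.
move=> ij; have ai := alpha_ge i; have aj := alpha_ge j.
exists ((normc (alpha i) + 1)^-1 * (normc (alpha j) + 1)^-1).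
  by rewrite mulr_gt0 ?invr_gt0//; lra.
move=> x y Xx Xy.
have /andP[bi _] := image_bounds i Xx; have /andP[bj _] := image_bounds j Xy.
move: bi bj; rewrite !enormE of_planeB.
have [] := s_image i Xx; have [] := s_image j Xy.
set z := of_plane (s i x); set z' := of_plane (s j y) => z'0 z'a z0 za bi bj.
have -> : z - z' = z * z' * (z'^-1 - z^-1) by field; rewrite z0 z'0.
rewrite normcM; apply: (@le_trans _ _ (normc (z * z') * 1)); last first.
  rewrite ler_wpM2l ?normc_ge0//.
  have sep := alpha_sep ij.
  have -> : z'^-1 - z^-1 = (z'^-1 - alpha j) - (z^-1 - alpha i) - (alpha i -
    alpha j) by ring.
  rewrite normcB; apply: le_trans (lerB_normcB _ _).
  have := ler_normcB (z'^-1 - alpha j) (z^-1 - alpha i); lra.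
by rewrite mulr1 normcM ler_pM ?invr_ge0//; lra.
Qed.

Lemma plane_system_stable i x : closed_disc x -> closed_disc (s i x).
Proof.
move=> Xx; have /andP[_ b] := image_bounds i Xx; have a101 := alpha_ge i.
rewrite closed_discE /=; apply: le_trans b _.
by rewrite invf_le1; lra.
Qed.

Let origin : E := 0.
Let unit_pt : E := to_plane 1.

Lemma origin_closed_disc : closed_disc origin.
Proof. by rewrite closed_discE /= enormE of_plane0 normc0. Qed.

Lemma unit_pt_closed_disc : closed_disc unit_pt.
Proof. by rewrite closed_discE /= enormE to_planeK normc1. Qed.

Lemma enorm_unit_pt : enorm (unit_pt - origin) = 1.
Proof. by rewrite subr0 enormE to_planeK normc1. Qed.

Lemma image_diff_le i j x y : closed_disc x -> closed_disc y ->
  enorm (s i x - s j y) <= (normc (alpha i) - 1)^-1 + (normc (alpha j) - 1)^-1.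
Proof.
move=> Xx Xy; have /andP[_ bi] := image_bounds i Xx.
have /andP[_ bj] := image_bounds j Xy.
rewrite enormE of_planeB; apply: le_trans (ler_normcB _ _) _.
by rewrite -!enormE lerD.
Qed.

Let rho w := enorm (word_map s w unit_pt - word_map s w origin).

(** The bound 101 is made for this: both image points have modulus at most 1/100, and 25 * 2 / 100 =
    1/2. *)
Lemma rho_contraction i : 25 * rho [:: i] <= 2^-1.
Proof.
have h := image_diff_le i i unit_pt_closed_disc origin_closed_disc.
have a101 := alpha_ge i.
have : (normc (alpha i) - 1)^-1 <= 100^-1 by rewrite lef_pV2 ?posrE; lra.
by rewrite /rho /=; lra.
Qed.

Lemma word_upper_bound w x y : closed_disc x -> closed_disc y ->
  enorm (word_map s w x - word_map s w y) <= 25 * rho w * enorm (x - y).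
Proof.
move=> Xx Xy; have [e [c [d [lo M]]]] := word_mobius w.
have := mobius_distortion M (closed_disc_sub_disc2 Xx) (closed_disc_sub_disc2 Xy)
  (closed_disc_sub_disc2 unit_pt_closed_disc) (closed_disc_sub_disc2
    origin_closed_disc).
by rewrite enorm_unit_pt mulr1.
Qed.

Lemma word_lower_bound w x y : closed_disc x -> closed_disc y ->
  rho w / 25 * enorm (x - y) <= enorm (word_map s w x - word_map s w y).
Proof.
move=> Xx Xy; have [e [c [d [lo M]]]] := word_mobius w.
have := mobius_distortion M (closed_disc_sub_disc2 unit_pt_closed_disc)
  (closed_disc_sub_disc2 origin_closed_disc)
  (closed_disc_sub_disc2 Xx) (closed_disc_sub_disc2 Xy).
rewrite enorm_unit_pt mulr1 -/(rho w) => h.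
by rewrite mulrAC ler_pdivrMr// [leRHS]mulrC.
Qed.

Lemma rho_word_gt0 w : 0 < rho w.
Proof.
have [e [c [d [lo M]]]] := word_mobius w.
rewrite /rho lt_def enorm_ge0 andbT enorm_eq0 subr_eq0; apply/eqP.
move/(mobius_inj M (closed_disc_sub_disc2 unit_pt_closed_disc)
  (closed_disc_sub_disc2 origin_closed_disc)) => eq.
by have := enorm_unit_pt; rewrite eq subrr => /eqP;
  rewrite enormE of_plane0 normc0 eq_sym oner_eq0.
Qed.

Lemma word_image_closed w : closed (word_map s w @` closed_disc).
Proof.
have [e [c [d [lo M]]]] := word_mobius w.
apply: compact_closed; first exact: norm_hausdorff.
apply: continuous_compact; last exact: closed_disc_compact.
apply: continuous_in_subspaceT => x /[!inE] /closed_disc_sub_disc2.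
apply: enorm_lipschitz_continuous; first exact: disc2_open.
exact: mobius_lipschitz M.
Qed.

Lemma plane_system_is_CIFS : is_CIFS closed_disc s.
Proof.
have half i x y : closed_disc x -> closed_disc y ->
    enorm (s i x - s i y) <= 2^-1 * enorm (x - y).
  move=> Xx Xy; apply: le_trans (word_upper_bound [:: i] Xx Xy) _.
  by rewrite ler_wpM2r ?enorm_ge0// rho_contraction.
split.
- split.
  + exact: closed_disc_compact.
  + exact: closed_disc_connected.
  + split; first exact: countableP.
    by exists (0%N, Ordinal T_gt0), (1%N, Ordinal T_gt0).
  + move=> i; split; first by move=> _ [x Xx <-]; exact: plane_system_stable.
    have [e [c [d [lo M]]]] := word_mobius [:: i].
    move=> x y /[!inE] /closed_disc_sub_disc2 Vx /closed_disc_sub_disc2 Vy.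
    exact: (mobius_inj M Vx Vy).
  + apply: (@le_lt_trans _ _ (2^-1)%:E); last by rewrite lte_fin invf_lt1// ltr1n.
    apply: ge_ereal_sup => _ [i _ <-]; apply: ge_ereal_sup =>
      _ [x [y [Xx Xy xy ->]]].
    rewrite lee_fin ler_pdivrMr ?half//.
    by rewrite lt_def enorm_ge0 andbT enorm_eq0 subr_eq0.
- move=> i j /plane_system_gap[d d0 gap].
  apply/seteqP; split=> //
    _ [[x /interior_subset Xx <-] [y /interior_subset Xy xy]].
  have := gap _ _ Xx Xy; rewrite xy subrr enormE of_plane0 normc0.
  by rewrite leNgt d0.
- exact: closed_disc_cone.
(* The letters are their own extensions to [disc2]. *)
- exists (@disc2 R), s; split.
    split.
    + exact: disc2_open.
    + exact: disc2_connected.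
    + exact: closed_disc_sub_disc2.
    + exists 1 => [|i]; first exact: ltr01.
      have [e [c [d [lo M]]]] := word_mobius [:: i]; split.
      * by [].
      * by move=> _ [x Vx <-]; exact: s_disc2.
      * exact: mobius_diffeo M.
      * exact: mobius_conformal M (@disc2_open R).
  exists 25; first by rewrite ler1n.
  move=> w x y _ Vx Vy; have [e [c [d [lo M]]]] := word_mobius w.
  exact: (mobius_opnorm_distortion M (@disc2_open R)).
Qed.

End PlaneSystem.

(** * Parameters of modulus (n + L) ^ gamma *)

Section PowerSystem.
Local Open Scope complex_scope.
Import Normc.
Variables (R : realType) (T : nat).
Local Notation E := 'rV[R]_2.
Local Notation C := R[i].
Local Notation I := (nat * 'I_T)%type.
Variables (gamma : R) (L : nat) (alpha : I -> C) (s : I -> E -> E).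
(** The ratios are of order (n + L) ^ (- 2 gamma). As 2 gamma t1 = 3/2 > 1, their powers have a sum
    that tends to 0 as [L] grows, while gamma t1 = 3/4 < 1. Exponents between 1 / (2 gamma) and 1 /
    gamma share both properties. *)
Let t1 : R := 3 / (4 * gamma).
Hypothesis T_gt0 : (0 < T)%N.
Hypothesis gamma_gt1 : 1 < gamma.
Hypothesis L_gt0 : (0 < L)%N.
Hypothesis alphaE : forall i, normc (alpha i) = (i.1.+1 + L)%:R `^ gamma.
Hypothesis alpha_ge : forall i, 101 <= normc (alpha i).
Hypothesis alpha_sep : forall i j, i <> j -> 3 <= normc (alpha i - alpha j).
Hypothesis word_mobius : forall w, exists e c d lo,
  mobius_on (@disc2 R) (word_map s w) e c d lo.
Hypothesis s_disc2 : forall i x, disc2 x -> disc2 (s i x).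
Hypothesis s_image : forall i x, closed_disc x ->
  of_plane (s i x) != 0 /\ normc ((of_plane (s i x))^-1 - alpha i) <= 1.
Let rho i := enorm (s i (to_plane 1) - s i 0).
Hypothesis rho_bounds : forall i,
  2^-1 / normc (alpha i) ^+ 2 <= rho i <= 2 / normc (alpha i) ^+ 2.
Hypothesis L_large : T%:R * (2 `^ t1 * (2 / Num.sqrt L%:R)) <= 2^-1 / 25 `^ t1.

Let gamma_gt0 : 0 < gamma. Proof. exact: lt_trans ltr01 gamma_gt1. Qed.

Let powRNN (y : R) : 0 <= y -> (y `^ gamma ^+ 2)^-1 = y `^ (- gamma) * y `^ (-
  gamma).
Proof. by move=> y0; rewrite expr2 invfM powRN. Qed.

(** The right-hand side is the integral of t ^ (- 3/2) from y - 1 to y. Algebraically, 1 / p - 1 / q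
    = 1 / (p q (p + q)) because q ^ 2 - p ^ 2 = 1, and p <= q. *)
Lemma inv_sqrt_cube_le (y : R) : 1 < y ->
  y `^ (- (3 / 2)) <= 2 * ((Num.sqrt (y - 1))^-1 - (Num.sqrt y)^-1).
Proof.
move=> y1; set p := Num.sqrt (y - 1); set q := Num.sqrt y.
have p0 : 0 < p by rewrite sqrtr_gt0 subr_gt0.
have q0 : 0 < q by rewrite sqrtr_gt0; lra.
have pq : q ^+ 2 = p ^+ 2 + 1 by rewrite !sqr_sqrtr; lra.
have -> : y `^ (- (3 / 2)) = (q ^+ 3)^-1.
  rewrite powRN mulrC powRrM powR12_sqrt; last by lra.
  by rewrite -/q -powR_mulrn ?(ltW q0).
have pq1 : p <= q by rewrite ler_sqrt; lra.
have -> : p^-1 - q^-1 = (p * q * (q + p))^-1.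
  have e : (q - p) * (q + p) = 1 by rewrite -subr_sqr pq addrAC subrr add0r.
  rewrite -[(p * q * _)^-1]mul1r -{1}e; field.
  by rewrite !gt_eqF// addr_gt0.
rewrite -[leLHS]mul1r ler_pdivrMr ?exprn_gt0// mulrAC.
rewrite ler_pdivlMr ?mulr_gt0 ?addr_gt0// mul1r.
have -> : 2 * q ^+ 3 = q * q * (q + q) by ring.
by rewrite !ler_pM ?lerD ?mulr_ge0 ?addr_ge0 ?(ltW p0) ?(ltW q0).
Qed.

Lemma sum_powR_le N : \sum_(n <- iota 0 N) (n.+1 + L)%:R `^ (- (3 / 2)) <=
  2 / Num.sqrt L%:R - 2 / Num.sqrt (N + L)%:R :> R.
Proof.
elim: N => [|N IH]; first by rewrite big_nil add0n subrr.
rewrite -addn1 iotaD big_cat/= big_seq1 add0n.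
have NL : (1 : R) < (N.+1 + L)%:R by rewrite ltr1n addSn ltnS addn_gt0 L_gt0 orbT.
have := inv_sqrt_cube_le NL.
have -> : (N.+1 + L)%:R - 1 = (N + L)%:R :> R by rewrite addSn -natr1 addrK.
rewrite addn1; lra.
Qed.

Lemma power_system_measure0 :
  let J := limit_set closed_disc s in
  hausdorff_measure (hausdorff_dim J) J = 0%E.
Proof.
have t10 : 0 < t1 by rewrite divr_gt0 ?mulr_gt0.
have gt1 : gamma * t1 = 3 / 4.
  by rewrite /t1; field; rewrite gt_eqF.
(* For [i.1 < N + N] and [L <= N] one has [i.1.+1 + L <= 3 * N], whence the 3; the factor 1/2 is
   that of [rho_bounds]. *)
pose c : R := 2^-1 * (3 `^ (- gamma) * 3 `^ (- gamma)).
apply: (@hausdorff_measure_hausdorff_dim_eq0 R 2 T s closed_disc (to_plane 1) 0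
  25 4 c gamma t1 L) => //.
- by rewrite ler1n.
- by rewrite !mulr_gt0 ?powR_gt0 ?invr_gt0.
- by rewrite gt1; lra.
- exact: closed_disc_compact.
- move=> x y; rewrite closed_discE /= => x1 y1.
  rewrite enormE of_planeB; apply: le_trans (ler_normcB _ _) _.
  by rewrite -!enormE; lra.
- exact: unit_pt_closed_disc.
- exact: origin_closed_disc.
- exact: enorm_unit_pt.
- move=> i x; exact: (plane_system_stable alpha_ge s_image).
- exact: (word_image_closed word_mobius).
- exact: (rho_word_gt0 word_mobius).
- exact: (word_lower_bound word_mobius).
- exact: (word_upper_bound word_mobius).
- exact: (rho_contraction alpha_ge s_image).
- exact: (plane_system_gap alpha_ge alpha_sep s_image).
(* Each of the two points has modulus at most 2 N ^ (- gamma), whence the value 4 for [M]. *)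
- move=> N i x y j N0 Ni Nj Xx Xy.
  have inv_le k : (N <= k.1)%N -> (normc (alpha k) - 1)^-1 <= 2 * N%:R `^ (- gamma).
    move=> Nk; have a101 := alpha_ge k.
    apply: (@le_trans _ _ (2 * (normc (alpha k))^-1)).
      rewrite -[leLHS]mul1r ler_pdivrMr; last by lra.
      by rewrite mulrAC ler_pdivlMr; lra.
    rewrite ler_wpM2l// powRN lef_pV2 ?posrE ?powR_gt0 ?ltr0n//; last by lra.
    rewrite alphaE; apply: ge0_ler_powR; rewrite ?nnegrE ?(ltW gamma_gt0)//.
    by rewrite ler_nat (leq_trans Nk)// (leq_trans (leqnSn _))// leq_addr.
  apply: le_trans (image_diff_le alpha_ge s_image _ _ Xx Xy) _.
  have := inv_le i Ni; have := inv_le j Nj; lra.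
- move=> N i LN iN; have /andP[+ _] := rho_bounds i; apply: le_trans.
  have -> : c * N%:R `^ (- gamma) * N%:R `^ (- gamma) =
      2^-1 * ((3 * N%:R) `^ (- gamma) * (3 * N%:R) `^ (- gamma)).
    by rewrite /c powRM// ?ler0n//; ring.
  rewrite -powRNN ?mulr_ge0 ?ler0n// ler_wpM2l// ?invr_ge0//.
  have N0 : (0 < N)%N by exact: leq_trans LN.
  rewrite lef_pV2 ?posrE ?exprn_gt0 ?powR_gt0 ?mulr_gt0 ?ltr0n//; last first.
    by apply: lt_le_trans (alpha_ge i).
  rewrite lerXn2r ?nnegrE ?powR_ge0//; first by rewrite alphaE powR_ge0.
  rewrite alphaE; apply: ge0_ler_powR;
    rewrite ?nnegrE ?mulr_ge0 ?ler0n ?(ltW gamma_gt0)//.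
  rewrite -natrM ler_nat (_ : 3 * N = (N + N) + N)%N;
    last by rewrite !mulSn mul0n addn0 addnA.
  by rewrite leq_add.
(* Each [n] carries [T] letters, and at exponent [t1] each of them contributes at most 2 ^ t1 (n + 1
   + L) ^ (- 3/2). *)
- move=> N; rewrite big_allpairs_dep/=.
  apply: (@le_trans _ _ (\sum_(n <- iota 0 N) T%:R * (2 `^ t1 * (n.+1 + L)%:R `^
    (- (3 / 2))))).
    apply: ler_sum => n _;
      rewrite big_enum /= -[X in X%:R * _](card_ord T) mulr_natl -sumr_const.
    apply: ler_sum => j _; have /andP[_ h] := rho_bounds (n, j).
    have -> : (n.+1 + L)%:R `^ (- (3 / 2)) = ((n.+1 + L)%:R `^ (- gamma) * (n.+1
      + L)%:R `^ (- gamma)) `^ t1 :> R.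
      rewrite -powRD; last by apply/implyP => _; rewrite pnatr_eq0.
      rewrite -powRrM; congr (_ `^ _).
      by have := gt1; lra.
    rewrite -powRM ?mulr_ge0 ?powR_ge0//.
    apply: (ge0_ler_powR (ltW t10));
      rewrite ?nnegrE ?enorm_ge0 ?mulr_ge0 ?powR_ge0//.
    by rewrite -powRNN ?ler0n// -(alphaE (n, j)).
  apply: le_trans L_large; rewrite -mulr_sumr ler_wpM2l//
    -mulr_sumr ler_wpM2l ?powR_ge0//.
  apply: le_trans (sum_powR_le N) _.
  by rewrite gerBl divr_ge0 ?sqrtr_ge0.
Qed.

End PowerSystem.

(** * The systems of the theorem *)

Section Systems.
Local Open Scope complex_scope.
Import Normc.
Variable R : realType.
Local Notation E := 'rV[R]_2.
Local Notation C := R[i].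

Lemma of_plane_map (phi : C -> C) (x : E) : of_plane (plane_map phi x) = phi
  (of_plane x).
Proof. exact: to_planeK. Qed.

Lemma f_mapE (a z : C) : f_map a z = (z + a^*) / (normc a ^+ 2 - 1)%:C.
Proof. by rewrite /f_map complex_normE rmorphB rmorphXn rmorph1. Qed.

Lemma normc_sqrE (z : C) : normc z ^+ 2 = complex.Re z ^+ 2 + complex.Im z ^+ 2.
Proof. by case: z => u v; rewrite sqr_sqrtr// addr_ge0 ?sqr_ge0. Qed.

Section Letters.
Variable a : C.
Hypothesis a_ge : 101 <= normc a.

Let sqr_big : 101 * normc a <= normc a ^+ 2.
Proof. by rewrite expr2 ler_wpM2r// normc_ge0. Qed.

Let den_gt0 : 0 < normc a ^+ 2 - 1.
Proof. by have := a_ge; have := sqr_big; lra. Qed.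

Let denC_neq0 : (normc a ^+ 2 - 1)%:C != 0.
Proof. by rewrite -normc_gt0 normc_real normr_gt0 gt_eqF. Qed.

Lemma f_map_norm z : normc (f_map a z) = normc (z + a^*) / (normc a ^+ 2 - 1).
Proof. by rewrite f_mapE normcM normcV normc_real gtr0_norm. Qed.

Lemma f_map_disc2 (x : E) : disc2 x -> disc2 (plane_map (f_map a) x).
Proof.
rewrite /disc2 /= !enormE of_plane_map => x2.
rewrite f_map_norm ltr_pdivrMr//.
have := le_normcD (of_plane x) a^*; rewrite normc_conj.
by have := a_ge; have := sqr_big; lra.
Qed.

(** The inverse of [f_map a z] differs from [a] by - (1 + a z) / (z + conj a). This has modulus at
    most 1 on the closed disc, since |z + conj a| ^ 2 - |1 + a z| ^ 2 = (1 - |z| ^ 2) (|a| ^ 2 -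
    1). *)
Lemma f_map_image (x : E) : closed_disc x ->
  of_plane (plane_map (f_map a) x) != 0 /\
  normc ((of_plane (plane_map (f_map a) x))^-1 - a) <= 1.
Proof.
rewrite closed_discE /= enormE of_plane_map; set z := of_plane x => z1.
have n0 : z + a^* != 0.
  rewrite -normc_gt0; have := lerB_normcD a^* z.
  by rewrite normc_conj [a^* + z]addrC; have := a_ge; lra.
split; first by rewrite f_mapE mulf_neq0// invr_eq0.
have aa : a * a^* = (normc a ^+ 2)%:C.
  by rewrite -sqr_normc complex_normE rmorphXn.
have -> : (f_map a z)^-1 - a = - (1 + a * z) / (z + a^*).
  have dE : (normc a ^+ 2 - 1)%:C = a * a^* - 1 by rewrite rmorphB rmorph1 aa.
  have d0 : a * a^* - 1 != 0 by rewrite -dE.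
  by rewrite f_mapE dE; field; rewrite n0 d0.
rewrite normcM normcV normcN ler_pdivrMr ?normc_gt0// mul1r.
rewrite -ler_sqr ?nnegrE ?normc_ge0//.
have z2 : normc z ^+ 2 <= 1 by rewrite expr_le1 ?normc_ge0.
have -> : normc (z + a^*) ^+ 2 =
    normc (1 + a * z) ^+ 2 + (1 - normc z ^+ 2) * (normc a ^+ 2 - 1).
  rewrite !normc_sqrE; case: (a) => a1 a2; case: (z) => z1' z2' /=; ring.
by rewrite lerDl mulr_ge0 ?(ltW den_gt0)// subr_ge0.
Qed.

Lemma f_map_dist (x y : E) :
  of_plane (plane_map (f_map a) x) - of_plane (plane_map (f_map a) y) =
  (normc a ^+ 2 - 1)%:C^-1 * (of_plane x - of_plane y).
Proof. by rewrite !of_plane_map !f_mapE -mulrBl opprD addrACA subrr addr0 mulrC.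
  Qed.

Lemma g_map_disc2 (x : E) : disc2 x -> disc2 (plane_map (g_map a) x).
Proof.
rewrite /disc2 /= !enormE of_plane_map /g_map => x2.
have := lerB_normcD a (of_plane x); have := a_ge.
rewrite mul1r normcV [a + _]addrC => a1 h.
rewrite -[ltLHS]mul1r ltr_pdivrMr; lra.
Qed.

Lemma g_map_den_neq0 (x : E) : disc2 x -> of_plane x + a != 0.
Proof.
rewrite /disc2 /= enormE -normc_gt0 => x2.
have := lerB_normcD a (of_plane x); have := a_ge; rewrite [a + _]addrC; lra.
Qed.

Lemma g_map_image (x : E) : closed_disc x ->
  of_plane (plane_map (g_map a) x) != 0 /\
  normc ((of_plane (plane_map (g_map a) x))^-1 - a) <= 1.
Proof.
move=> Xx; have n0 := g_map_den_neq0 (closed_disc_sub_disc2 Xx).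
rewrite of_plane_map /g_map mul1r; split; first by rewrite invr_eq0.
by rewrite invrK addrK -enormE; move: Xx; rewrite closed_discE.
Qed.

Lemma f_map_rho : 2^-1 / normc a ^+ 2 <=
  enorm (plane_map (f_map a) (to_plane 1) - plane_map (f_map a) 0) <=
  2 / normc a ^+ 2.
Proof.
set rho := enorm _; have -> : rho = (normc a ^+ 2 - 1)^-1.
  rewrite /rho enormE of_planeB f_map_dist to_planeK of_plane0 subr0 mulr1.
  by rewrite normcV normc_real gtr0_norm.
have a2 : 0 < normc a ^+ 2 by have := a_ge; have := sqr_big; lra.
rewrite -[_^-1 in X in _ <= X <= _]mul1r.
rewrite ler_pdivrMr// mulrAC ler_pdivlMr// ler_pdivrMr// mulrAC ler_pdivlMr//.
by have := a_ge; have := sqr_big; lra.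
Qed.

Lemma g_map_rho : 2^-1 / normc a ^+ 2 <=
  enorm (plane_map (g_map a) (to_plane 1) - plane_map (g_map a) 0) <=
  2 / normc a ^+ 2.
Proof.
set rho := enorm _.
have n1 : 1 + a != 0.
  have /g_map_den_neq0 := closed_disc_sub_disc2 (@unit_pt_closed_disc R).
  by rewrite to_planeK.
have n0 : a != 0 by rewrite -normc_gt0; have := a_ge; lra.
have -> : rho = (normc (1 + a) * normc a)^-1.
  rewrite /rho enormE of_planeB !of_plane_map to_planeK of_plane0 /g_map add0r.
  have -> : 1 / (1 + a) - 1 / a = - ((1 + a) * a)^-1 by field; rewrite n0 n1.
  by rewrite normcN normcV normcM.
have a0 : 0 < normc a by have := a_ge; lra.
have h1 := lerB_normcD a 1; have h2 := le_normcD a 1.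
rewrite normc1 [a + 1]addrC in h1 h2.
have b0 : 0 < normc (1 + a) by have := a_ge; lra.
rewrite expr2; apply/andP; split.
  rewrite ler_pdivrMr ?mulr_gt0// mulrC ler_pdivlMr ?mulr_gt0// !mulrA ler_pM2r//.
  by have := a_ge; lra.
rewrite -[leLHS]mul1r ler_pdivrMr ?mulr_gt0// mulrAC ler_pdivlMr ?mulr_gt0//.
by rewrite mul1r !mulrA ler_pM2r//; have := a_ge; lra.
Qed.

End Letters.

Variables (T : nat) (d : nat -> R).
Hypothesis param_ge : forall p : nat * 'I_T, 101 <= normc (param d p).

Lemma F_word_mobius w : exists e c c' lo,
  mobius_on (@disc2 R) (word_map (@F_system R d T) w) e c c' lo.
Proof.
have [e e0 we] : exists2 e : C, e != 0 & forall x y : E,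
    of_plane (word_map (@F_system R d T) w x) - of_plane (word_map (@F_system R d
      T) w y) =
    e * (of_plane x - of_plane y).
  elim: w => [|i w [e e0 IH]]; first by exists 1 => [|x y];
    rewrite ?oner_neq0 ?mul1r.
  have a101 := param_ge i.
  exists ((normc (param d i) ^+ 2 - 1)%:C^-1 * e) => [|x y].
    rewrite mulf_neq0// invr_eq0 -normc_gt0 normc_real normr_gt0.
    rewrite subr_eq0 gt_eqF// exprn_egt1//; lra.
  by rewrite /= /F_system (f_map_dist (param d i)) IH mulrA.
(* Words of affine maps are affine: the denominator is the constant 1. *)
exists e, 0, 1, 1; split=> // x; first by rewrite mul0r add0r normc1; lra.
by move=> y _ _; rewrite we !mul0r !add0r mul1r divr1.
Qed.

(* With [(c, c')] the bottom row of the matrix of a word, right multiplication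
   by the matrix of [g_alpha] gives [(c', c + c' * alpha)]; this preserves
   [3 |c| <= |c'|]. *)
Lemma G_word_mobius w : exists e c c' lo,
  mobius_on (@disc2 R) (word_map (@G_system R d T) w) e c c' lo.
Proof.
suff [e [c [c' [e0 c'0 cc' we]]]] : exists e c c' : C,
    [/\ e != 0, c' != 0, 3 * normc c <= normc c' &
      forall x y : E, disc2 x -> disc2 y ->
      of_plane (word_map (@G_system R d T) w x) - of_plane (word_map (@G_system R
        d T) w y) =
      e * (of_plane x - of_plane y) / ((c * of_plane x + c') * (c * of_plane y +
        c'))].
  (* For |x| < 2 and 3 |c| <= |c'|, the modulus of c x + c' lies between |c'| / 3 and 5 |c'| / 3.
     This is the origin of the factor 5 in [mobius_on]. *)
  exists e, c, c', (normc c' / 3); split=> // [|x].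
    by rewrite divr_gt0// normc_gt0.
  rewrite /disc2/= enormE => x2.
  have h1 := lerB_normcD c' (c * of_plane x);
    have h2 := le_normcD c' (c * of_plane x).
  have h3 : normc (c * of_plane x) <= normc c * 2.
    by rewrite normcM ler_wpM2l ?normc_ge0// ltW.
  by rewrite [c * _ + c']addrC; apply/andP; split; lra.
elim/last_ind: w => [|w i [e [c [c' [e0 c'0 cc' we]]]]].
  exists 1, 0, 1; split; rewrite ?oner_neq0 ?normc0 ?normc1 ?mulr0//.
  by move=> x y _ _; rewrite !mul0r !add0r !mul1r divr1.
have a101 := param_ge i; set a := param d i in a101.
have c'g : 0 < normc c' by rewrite normc_gt0.
have bound : 3 * normc c' <= normc (c + c' * a).
  have := lerB_normcD (c' * a) c; rewrite normcM [c' * a + c]addrC.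
  have : 101 * normc c' <= normc c' * normc a by rewrite mulrC ler_pM2l.
  lra.
(* The sign is the determinant -1 of the matrix of [g_map a]. *)
exists (- e), c', (c + c' * a); split; rewrite ?oppr_eq0//.
  by rewrite -normc_gt0; lra.
move=> x y Vx Vy.
have wE z : word_map (@G_system R d T) (rcons w i) z =
    word_map (@G_system R d T) w (plane_map (g_map a) z).
  by rewrite /word_map foldr_rcons; elim: (w) => //= j v ->.
have gx := g_map_disc2 a101 Vx; have gy := g_map_disc2 a101 Vy.
rewrite !wE we//.
have nx := g_map_den_neq0 a101 Vx; have ny := g_map_den_neq0 a101 Vy.
have big_neq0 z : disc2 z -> c' * of_plane z + (c + c' * a) != 0.
  rewrite /disc2/= enormE -normc_gt0 => z2.
  have := lerB_normcD (c + c' * a) (c' * of_plane z).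
  have : normc (c' * of_plane z) <= normc c' * 2.
    by rewrite normcM ler_wpM2l ?normc_ge0// ltW.
  rewrite [c' * _ + _]addrC; lra.
have mx := big_neq0 x Vx; have my := big_neq0 y Vy.
rewrite !of_plane_map /g_map; field.
have swap z : c + c' * (z + a) = c' * z + (c + c' * a) by ring.
by rewrite nx ny ?swap mx my.
Qed.


End Systems.

(** * Separation of the parameters *)

Section IndexSeparation.
Local Open Scope complex_scope.
Import Normc.
Variable R : realType.

Lemma normc_cis (theta : R) : normc (cis theta) = 1.
Proof. by rewrite /cis /= cos2Dsin2 sqrtr1. Qed.

(** Equality would make the cosine of the angle difference 1, while half that difference, pi (y -
    x), lies strictly between 0 and pi and has positive sine. *)
Lemma cis_neq (x y : R) : 0 <= x -> x < y -> y < 1 -> cis x != cis y.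
Proof.
move=> x0 xy y1; apply/eqP => -[ecos esin].
have p0 := pi_gt0 R.
have s0 : 0 < sin (pi * (y - x)).
  apply: sin_gt0_pi; rewrite mulr_gt0 ?subr_gt0//= gtr_pMr//; lra.
have : cos (2 * pi * y - 2 * pi * x) = 1.
  by rewrite cosB ecos esin -!expr2 cos2Dsin2.
have -> : 2 * pi * y - 2 * pi * x = (pi * (y - x)) *+ 2 by rewrite mulr2n; ring.
rewrite cos_mulr2n; have := cos2Dsin2 (pi * (y - x)).
set c2 := cos _ ^+ 2; rewrite -mulr_natl => h1 h2.
have : 0 < sin (pi * (y - x)) ^+ 2 by rewrite exprn_gt0.
lra.
Qed.

Lemma cis_gap (T : nat) : exists2 mu : R, 0 < mu & forall j k : 'I_T, j != k ->
  mu <= normc (cis (j%:R / T%:R) - cis (k%:R / T%:R)).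
Proof.
have neq (j k : 'I_T) : (j < k)%N -> cis (j%:R / T%:R) != cis (k%:R / T%:R) :> R[i].
  move=> jk; have T0 : (0 : R) < T%:R by rewrite ltr0n (leq_ltn_trans _ (ltn_ord
    k)).
  apply: cis_neq; first by rewrite divr_ge0 ?ler0n.
    by rewrite ltr_pM2r ?invr_gt0// ltr_nat.
  by rewrite ltr_pdivrMr// mul1r ltr_nat.
have [|p _|mu mu0 muP] := @common_lower_bound R _ (enum {: 'I_T * 'I_T})
    (fun p mu => p.1 != p.2 -> mu <= normc (cis (p.1%:R / T%:R) - cis (p.2%:R /
      T%:R))).
- by move=> p x y px yx /px; exact: le_trans.
- have [e|ne] := eqVneq p.1 p.2; first by exists 1.
  exists (normc (cis (p.1%:R / T%:R) - cis (p.2%:R / T%:R) : R[i])) => //.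
  rewrite normc_gt0 subr_eq0.
  have := ne; rewrite neq_ltn => /orP[/neq//|/neq]; by rewrite eq_sym.
- by exists mu => // j k jk; apply: (muP (j, k)) => //; rewrite mem_enum.
Qed.

Variables (gamma : R) (T L : nat).
Hypothesis gamma_gt1 : 1 < gamma.
Local Notation d := (power_seq gamma L).
Local Notation I := (nat * 'I_T)%type.

Let gamma_gt0 : 0 < gamma. Proof. exact: lt_trans gamma_gt1. Qed.

Lemma normc_param (i : I) : normc (param d i) = (i.1.+1 + L)%:R `^ gamma.
Proof.
by rewrite /param normcM normc_cis mul1r normc_real ger0_norm// powR_ge0.
Qed.

Lemma power_seq_ge n : (n + L)%:R <= d n.
Proof.
rewrite /power_seq; have [->|nL] := posnP (n + L)%N; first exact: powR_ge0.
by apply: le1r_powR; rewrite ?ler1n// ltW.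
Qed.

(** In the form (x + 1) v - x u with v >= u, where [u] and [v] are the powers gamma - 1, the
    increment is at least u. This stands in for the mean value theorem. *)
Lemma powR_incr_ge (x : R) : 0 < x -> x `^ (gamma - 1) <= (x + 1) `^ gamma - x `^
  gamma.
Proof.
move=> x0; have split (y : R) : 0 < y -> y `^ gamma = y * y `^ (gamma - 1).
  move=> y0; rewrite -{2}[y]powRr1 ?(ltW y0)// -powRD.
    by congr powR; lra.
  by apply/implyP => _; rewrite gt_eqF.
rewrite !split ?addr_gt0//.
have : x `^ (gamma - 1) <= (x + 1) `^ (gamma - 1).
  by apply: ge0_ler_powR; rewrite ?nnegrE ?subr_ge0 ?(ltW gamma_gt1)//; lra.
set u := x `^ _; set v := _ `^ _ => uv; have : 0 <= (x + 1) * (v - u).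
  by rewrite mulr_ge0 ?subr_ge0// addr_ge0 ?ltW.
lra.
Qed.

Hypothesis L_gt0 : (0 < L)%N.
Hypothesis L_incr : 3 <= L%:R `^ (gamma - 1).

Lemma power_seq_incr n : 3 <= d n.+1 - d n.
Proof.
have nL : (0 : R) < (n + L)%:R by rewrite ltr0n addn_gt0 L_gt0 orbT.
rewrite /power_seq addSn -[(n + L).+1%:R]natr1; apply: le_trans (powR_incr_ge nL).
apply: le_trans L_incr _; apply: ge0_ler_powR;
  rewrite ?nnegrE ?ler0n ?subr_ge0 ?(ltW gamma_gt1)//.
by rewrite ler_nat leq_addl.
Qed.

Lemma power_seq_gap n p : (n < p)%N -> 3 <= d p - d n.
Proof.
elim: p => // p IH; rewrite ltnS leq_eqVlt => /predU1P[->|/IH].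
  exact: power_seq_incr.
by have := power_seq_incr p; lra.
Qed.

Variable mu : R.
Hypothesis mu_gt0 : 0 < mu.
Hypothesis muP : forall j k : 'I_T, j != k ->
  mu <= normc (cis (j%:R / T%:R) - cis (k%:R / T%:R)).
Hypothesis L_mu : 6 / mu <= L%:R.

(** Equal arguments leave the gap between the moduli. For different ones the bounds [h1] and [h2]
    combine to show that twice the distance is at least [mu * x]; this is why [L_mu] asks for 6. *)
Lemma param_sep (i j : I) : i <> j -> 3 <= normc (param d i - param d j).
Proof.
case: i j => [n j] [p k] nej.
pose u := cis (j%:R / T%:R : R); pose v := cis (k%:R / T%:R : R).
pose x := d n.+1; pose y := d p.+1.
rewrite (_ : param d (n, j) = u * x%:C)// (_ : param d (p, k) = v * y%:C)//.
have nu : normc u = 1 by exact: normc_cis.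
have nv : normc v = 1 by exact: normc_cis.
have [ejk|njk] := eqVneq j k.
  have np : n != p by apply/eqP => np; apply: nej; rewrite np ejk.
  rewrite /v -ejk -/u -mulrBr normcM nu mul1r -rmorphB normc_real.
  move: np; rewrite neq_ltn => /orP[np|pn].
    rewrite distrC; apply: le_trans (ler_norm _).
    by apply: power_seq_gap; rewrite ltnS.
  by apply: le_trans (ler_norm _); apply: power_seq_gap; rewrite ltnS.
have x6 : 6 <= mu * x.
  rewrite mulrC -ler_pdivrMr//; apply: le_trans L_mu _.
  by apply: le_trans (power_seq_ge _); rewrite ler_nat leq_addl.
have x0 : 0 <= x by exact: powR_ge0.
have y0 : 0 <= y by exact: powR_ge0.
(* [|u x - v y| >= |x - y|] and [|u x - v y| >= |u - v| x - |x - y|] *)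
have h1 : `|x - y| <= normc (u * x%:C - v * y%:C).
  rewrite ler_norml; apply/andP; split.
    have := lerB_normcB (v * y%:C) (u * x%:C).
    by rewrite !normcM nu nv !mul1r !normc_real !ger0_norm// normcB; lra.
  have := lerB_normcB (u * x%:C) (v * y%:C).
  by rewrite !normcM nu nv !mul1r !normc_real !ger0_norm//; lra.
have h2 : normc ((u - v) * x%:C) <= normc (u * x%:C - v * y%:C) + `|x - y|.
  have -> : (u - v) * x%:C = (u * x%:C - v * y%:C) - v * (x - y)%:C.
    by rewrite rmorphB; ring.
  apply: le_trans (ler_normcB _ _) _.
  by rewrite [normc (v * _)]normcM nv mul1r normc_real.
rewrite normcM normc_real (ger0_norm x0) in h2.
have h3 : mu * x <= normc (u - v) * x by rewrite ler_wpM2r// muP.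
lra.
Qed.

End IndexSeparation.

(** * Choice of the threshold for L *)

Theorem theorem7 (R : realType) (gamma : R) (T : nat)
    (gamma_gt1 : 1 < gamma) (T_gt0 : (0 < T)%N) :
  exists L0 : nat, forall L : nat, (0 < L)%N -> (L0 <= L)%N ->
    let d := power_seq gamma L in
    let F := @F_system R d T in
    let G := @G_system R d T in
    let JF := limit_set closed_disc F in
    let JG := limit_set closed_disc G in
    [/\ admissible d, is_CIFS closed_disc F, is_CIFS closed_disc G,
        hausdorff_measure (hausdorff_dim JF) JF = 0%E &
        hausdorff_measure (hausdorff_dim JG) JG = 0%E].
Proof.
have [mu mu0 muP] := @cis_gap R T.
have g1 : 0 < gamma - 1 by rewrite subr_gt0.
pose t1 : R := 3 / (4 * gamma).
(* [L_large] is equivalent to [B <= Num.sqrt L%:R]. *)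
pose B : R := T%:R * (2 `^ t1 * 2) * (2 * 25 `^ t1).
have [N1 _ N1P] := exists_nat_powR_ge 3 0 g1.
have [N2 _ N2P] := @exists_nat_powR_ge R 1 (6 / mu) 0 ltr01.
have [N3 N30 N3P] := @exists_nat_powR_ge R 2^-1 B 0 (ltac:(by rewrite invr_gt0)).
(* In order: moduli of at least 101, radial gaps of at least 3, separation of the arguments, and
   smallness of the first-level sum. *)
exists (maxn 101 (maxn N1 (maxn N2 N3))) => L L0.
rewrite !geq_max => /and4P[L101 LN1 LN2 LN3] d F G JF JG.
have L_incr : 3 <= L%:R `^ (gamma - 1).
  apply: le_trans N1P _.
  by apply: ge0_ler_powR; rewrite ?nnegrE ?ler0n ?(ltW g1)// ler_nat.
have L_mu : 6 / mu <= L%:R.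
  by apply: le_trans N2P _; rewrite powRr1 ?ler0n// ler_nat.
have L_large : T%:R * (2 `^ t1 * (2 / Num.sqrt L%:R)) <= 2^-1 / 25 `^ t1.
  have p25 : (0 : R) < 25 `^ t1 by rewrite powR_gt0.
  have sL : 0 < Num.sqrt L%:R :> R by rewrite sqrtr_gt0 ltr0n.
  have BL : B <= Num.sqrt L%:R.
    apply: le_trans N3P _; rewrite powR12_sqrt ?ler0n// ler_sqrt ?ler0n//.
    by rewrite ler_nat.
  rewrite ler_pdivlMr// [leLHS](_ : _ = B / 2 / Num.sqrt L%:R).
    by rewrite ler_pdivrMr//; lra.
  by rewrite /B; field; rewrite gt_eqF.
have param_ge (p : nat * 'I_T) : 101 <= Normc.normc (param d p).
  rewrite normc_param; apply: le_trans (power_seq_ge L gamma_gt1 p.1.+1).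
  by rewrite ler_nat (leq_trans L101)// leq_addl.
have sep := param_sep gamma_gt1 L0 L_incr mu0 muP L_mu.
have normE := @normc_param R gamma T L.
have Fw := F_word_mobius param_ge; have Gw := G_word_mobius param_ge.
have Fi i := f_map_image (param_ge i); have Gi i := g_map_image (param_ge i).
have Fd i := f_map_disc2 (param_ge i); have Gd i := g_map_disc2 (param_ge i).
split.
- split=> [|n _]; last by have := power_seq_incr gamma_gt1 L0 L_incr n;
  rewrite -/d; lra.
  apply: le_trans (power_seq_ge L gamma_gt1 1).
  by rewrite ler_nat (leq_trans _ (leq_addl _ _))// (leq_trans _ L101).
- exact: (plane_system_is_CIFS T_gt0 param_ge sep Fw Fd Fi).
- exact: (plane_system_is_CIFS T_gt0 param_ge sep Gw Gd Gi).
- apply: (power_system_measure0 T_gt0 gamma_gt1 L0 normE param_ge sep Fw Fi _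
  L_large).
  by move=> i; exact: (f_map_rho (param_ge i)).
- apply: (power_system_measure0 T_gt0 gamma_gt1 L0 normE param_ge sep Gw Gi _
  L_large).
  by move=> i; exact: (g_map_rho (param_ge i)).
Qed.
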